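(* Let $G$ be an abelian group, let $\mathcal D$ be a finite-dimensional real $G$-graded division algebra whose center $Z(\mathcal D)$ is isomorphic to $\mathbb C$ and trivially graded (so $\mathcal D_e=Z(\mathcal D)\cong\mathbb C$), with support $T$, and let $\varphi_0$ be a degree-preserving involution on $\mathcal D$ restricting to the conjugation on $\mathcal D_e$. If $T$ is an elementary $2$-group, pick $\nu:T\to\{\pm1\}$ such that $\nu(st)=\nu(s)\nu(t)\beta(s,t)$ for all $s,t\in T$. Let $(g_0,\kappa,\sigma),(g_0',\kappa',\sigma')\in\mathsf X(G,\mathcal D,\varphi_0,1)$. Then the graded algebras with involution $M(\mathcal D,\varphi_0,g_0,\kappa,\sigma,1)$ and $M(\mathcal D,\varphi_0,g_0',\kappa',\sigma',1)$ are isomorphic if and only if (1) when $T$ is not an elementary $2$-group: $(g_0',\kappa',\sigma')$ lies in the same $G\times\{\pm1\}$-orbit as $(g_0,\kappa,\sigma)$; (2) when $T$ is an elementary $2$-group: $(g_0',\kappa',\sigma')$ lies in the same $G\times\{\pm1\}$-orbit as $(g_0,\kappa,\sigma)$ or $(g_0,\kappa,\nu\sigma)$, where $(\nu\sigma)(x)=\nu(g_0\xi(x)^2)\sigma(x)$.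
   Context: $G$ is written multiplicatively, with identity $e$. A graded division algebra is a unital (nonzero) associative $G$-graded algebra in which every nonzero homogeneous element is invertible; its support $T$ is a subgroup of $G$. Isomorphisms of graded algebras with involution preserve degrees and intertwine the involutions. Notation. For each $t\in T$ fix $0\ne X_t\in\mathcal D_t$ with $\varphi_0(X_t)=X_t$ (possible here). Define $\beta:T\times T\to\mathcal D_e^\times$ by $X_sX_t=\beta(s,t)X_tX_s$. Fix a section $\xi:G/T\to G$ of the quotient map. For $g_0\in G$ let $(G/T)_{g_0}=\{gT\mid g_0g^2\in T\}$ and $\tau(x)=g_0\xi(x)^2\in T$ for $x\in(G/T)_{g_0}$. $\mathsf X(G,\mathcal D,\varphi_0,1)$ is the set of triples $(g_0,\kappa,\sigma)$ where $g_0\in G$; $\kappa:G/T\to\mathbb Z_{\ge0}$ (not identically zero) has finite support and satisfies $\kappa(g_0^{-1}x^{-1})=\kappa(x)$ for all $x\in G/T$; $\sigma:G/T\to\mathbb Z$ satisfies $|\sigma(x)|\le\kappa(x)$ for all $x$, $\sigma(x)=0$ for $x\notin(G/T)_{g_0}$, and $\sigma(x)\equiv\kappa(x)\pmod 2$ for $x\in(G/T)_{g_0}$. ($\nu\sigma$ is understood to be $0$ where $\sigma$ is $0$.) Write $|\kappa|=\sum_x\kappa(x)$. $M(\mathcal D,\varphi_0,g_0,\kappa,\sigma,1)$: let $x_1,\dots,x_s$ be the distinct elements of the support of $\kappa$, ordered so that $x_1,\dots,x_m\in(G/T)_{g_0}$ and the others come in pairs with $x_{m+2j-1}x_{m+2j}=g_0^{-1}T$,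 $j=1,\dots,r$, $m+2r=s$. Let $g_i=\xi(x_i)$, $k_i=\kappa(x_i)$, $k=|\kappa|$. The algebra is $M_k(\mathcal D)=M_k(\mathbb R)\otimes_{\mathbb R}\mathcal D$, partitioned into $s^2$ blocks according to $k=k_1+\dots+k_s$, with $\deg(E\otimes d)=g_itg_j^{-1}$ for a matrix unit $E$ in the $(i,j)$ block and $d\in\mathcal D_t$. The involution is $\varphi(X)=\Phi^{-1}\varphi_0(X^T)\Phi$ ($\varphi_0$ applied entrywise), where $\Phi=X_{t_1}S_1\oplus\dots\oplus X_{t_{m+r}}S_{m+r}$ with: for $1\le i\le m$, $t_i=\tau(x_i)$ and $S_i=\mathrm{diag}(I_{p_i},-I_{q_i})$, $p_i=\frac12(\kappa(x_i)+\sigma(x_i))$, $q_i=\frac12(\kappa(x_i)-\sigma(x_i))$; for $1\le j\le r$, $t_{m+j}=g_0g_{m+2j-1}g_{m+2j}$ and $S_{m+j}=\begin{pmatrix}0&I_{k_{m+2j}}\\ I_{k_{m+2j}}&0\end{pmatrix}$. Actions on $\mathsf X(G,\mathcal D,\varphi_0,1)$: $\epsilon\in\{\pm1\}$ acts by $\epsilon\cdot(g_0,\kappa,\sigma)=(g_0,\kappa,\epsilon\sigma)$; $g\in G$ acts by $g\cdot(g_0,\kappa,\sigma)=(g^{-2}g_0,g\cdot\kappa,\underline\sigma)$, where $(g\cdot\kappa)(x)=\kappa(g^{-1}x)$ and $\underline\sigma(x)=\mathrm{sign}\big(X_{tu^2}^{-1}X_uX_tX_u\big)\sigma(g^{-1}x)$,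 with $t=g_0\xi(g^{-1}x)^2$ and $u=\xi(g^{-1}x)^{-1}g^{-1}\xi(x)\in T$ (if $\sigma(g^{-1}x)=0$ then $\underline\sigma(x)=0$; otherwise $t\in T$ and the element whose sign is taken is a nonzero real number). *)

(* Defs.v *)
From HB Require Import structures.
From mathcomp Require Import all_boot all_order all_algebra all_field.
From mathcomp Require Import boolp classical_sets cardinality reals.
From mathcomp Require Import complex.

Set Implicit Arguments.
Unset Strict Implicit.
Unset Printing Implicit Defensive.

Import Order.TTheory GRing.Theory Num.Theory.

Local Open Scope ring_scope.
Local Open Scope quotient_scope.

(* Abelian groups are [zmodType]s, hence written additively: the identity e   *)
(* is 0, gh is g + h, g^-1 is - g and g^2 is g *+ 2.                          *)

(* Finite-dimensional graded division algebras. Since G may be infinite, the  *)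
(* decomposition into the direct sum of the components is expressed by finite *)
(* subfamilies: finitely many components span, and distinct ones are          *)
(* independent. An [falgType] is nonzero, unital and finite-dimensional.      *)
Record grDivAlg (R : fieldType) (G : zmodType) := GrDivAlg {
  gr_alg :> falgType R;
  gr_comp : G -> {vspace gr_alg};
  gr_span : exists (n : nat) (g : 'I_n -> G),
    (\sum_(i < n) gr_comp (g i))%VS = fullv;
  gr_direct : forall (n : nat) (g : 'I_n -> G), injective g ->
    directv (\sum_(i < n) gr_comp (g i));
  gr_one : 1 \in gr_comp 0;
  gr_mul : forall g h x y,
    x \in gr_comp g -> y \in gr_comp h -> x * y \in gr_comp (g + h);
  gr_unit : forall g x, x \in gr_comp g -> x != 0 -> x \is a GRing.unit }.

Section Support.
Variables (R : fieldType) (G : zmodType) (D : grDivAlg R G).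
Local Notation Dg := (gr_comp D).

Definition supp : {pred G} := fun t => gr_comp D t != 0%VS.

Lemma suppP t : reflect (exists2 x, x \in Dg t & x != 0) (t \in supp).
Proof.
apply: (iffP idP) => [|[x xD]].
  rewrite unfold_in -subv0 => /subvPn[x xD x0]; exists x => //.
  by move: x0; rewrite memv0.
by apply: contra => /eqP D0; rewrite -memv0 -D0.
Qed.

Lemma gr_span_inj : exists (n : nat) (g : 'I_n -> G),
  injective g /\ (\sum_(i < n) Dg (g i))%VS = fullv.
Proof.
have [n [g gE]] := gr_span D.
pose s := undup (codom g); exists (size s), (fun i => nth 0 s i); split.
  by move=> i j /eqP; rewrite nth_uniq ?undup_uniq // => /eqP/val_inj.
apply/eqP; rewrite eqEsubv subvf -gE /=; apply/subv_sumP => i _.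
have gis : g i \in s by rewrite mem_undup codom_f.
have lt_is : (index (g i) s < size s)%N by rewrite index_mem.
by rewrite (sumv_sup (Ordinal lt_is)) //= nth_index.
Qed.

Lemma supp_opp t : t \in supp -> - t \in supp.
Proof.
move=> /suppP[x xD x0]; have ux := gr_unit xD x0.
have [n [g [g_inj gE]]] := gr_span_inj.
have /memv_sumP[y yD yE] : x^-1 \in (\sum_(i < n) Dg (g i))%VS.
  by rewrite gE memvf.
have xyE : \sum_(i < n) x * y i = 1 by rewrite -mulr_sumr -yE mulrV.
have xyD i : x * y i \in Dg (t + g i) by apply: gr_mul => //; apply: yD.
have tg_inj : injective (fun i => t + g i) by move=> i j /addrI/g_inj.
have [i0 gi0|g0] := pickP (fun i => t + g i == 0); last first.
  pose h (i : 'I_n.+1) := oapp (fun j => t + g j) 0 (unlift ord0 i).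
  pose u (i : 'I_n.+1) := oapp (fun j => x * y j) (- 1) (unlift ord0 i).
  have h_inj : injective h.
    move=> i j; rewrite /h; case: unliftP => [i'|] ->; case: unliftP => [j'|] ->//=.
    - by move=> /tg_inj ->.
    - by move=> /eqP; rewrite g0.
    - by move=> /esym/eqP; rewrite g0.
  have uD i : true -> u i \in Dg (h i).
    rewrite /u /h; case: unliftP => [j|] _ _ //=.
    by rewrite rpredN gr_one.
  have u0 : \sum_i u i = 0.
    rewrite big_ord_recl [u ord0]/u unlift_none /=; apply/eqP.
    rewrite addrC subr_eq0; apply/eqP; rewrite -xyE.
    by apply: eq_bigr => i _; rewrite /u liftK.
  have := elimT directv_sum_independent (gr_direct _ h_inj) u uD u0 ord0 isT.
  by rewrite /u unlift_none => /eqP; rewrite oppr_eq0 oner_eq0.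
pose u i := x * y i - (i == i0)%:R.
have uD i : true -> u i \in Dg (t + g i).
  move=> _; rewrite rpredB //; case: eqP => [->|]; last by rewrite mem0v.
  by rewrite (eqP gi0) gr_one.
have u0 : \sum_i u i = 0.
  rewrite sumrB xyE (bigD1 i0) //= eqxx big1 ?addr0 ?subrr // => i /negPf ->//.
have := elimT directv_sum_independent (gr_direct _ tg_inj) u uD u0 i0 isT.
rewrite /u eqxx => /eqP; rewrite subr_eq0 => /eqP xy1.
apply/suppP; exists (y i0).
  rewrite -(_ : g i0 = - t); first exact: yD.
  by apply/eqP; rewrite -addr_eq0 addrC.
by apply: contra_eq_neq xy1 => ->; rewrite mulr0 eq_sym oner_neq0.
Qed.

Lemma supp_zmod_closed : zmod_closed supp.
Proof.
split=> [|t s tT sT]; first by apply/suppP; exists 1; rewrite ?gr_one ?oner_neq0.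
have [x xD x0] := suppP _ tT; have [y yD y0] := suppP _ (supp_opp sT).
apply/suppP; exists (x * y); first exact: gr_mul.
by rewrite mulrI_eq0 //; apply: mulrI; apply: gr_unit xD x0.
Qed.

HB.instance Definition _ := GRing.isZmodClosed.Build G supp supp_zmod_closed.

End Support.

Section Setup.
Variables (R : realType) (G : zmodType) (D : grDivAlg R G).
Local Notation T := (supp D).
Local Notation Dg := (gr_comp D).

Definition elementary2 : Prop := forall t, t \in T -> t *+ 2 = 0.

Definition GT : zmodType := Quotient.quot T.

Definition cosetT (g : G) : GT := \pi_(Quotient.quot T) g.

(* [Rcomplex R] is R[i] equipped with its structure of R-algebra.             *)
Definition iso_center (iota : {lrmorphism Rcomplex R -> D}) : Prop :=
  injective iota /\ (forall d, d \in 'Z({:D})%VS <-> exists z, iota z = d).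

(* Involutions of an R-algebra are R-linear; the linearity is carried by the  *)
(* type.                                                                      *)
Definition is_involution (phi : {linear D -> D}) : Prop :=
  (forall x y, phi (x * y) = phi y * phi x) /\ (forall x, phi (phi x) = x).

(* The sign of an element of the real line R.1 of D.                          *)
Definition sgD (d : D) : int := sgz (xget 0 [set a : R | a%:A = d]%classic).

(* Only the values of [X] on the support T are relevant.                      *)
Variables (phi0 : {linear D -> D}) (X : G -> D) (xi : GT -> G).

Definition beta (s t : G) : D := X s * X t / (X t * X s).

(* The set (G/T)_{g0} of the cosets gT such that g0 g^2 is in T.              *)
Definition GTsq (g0 : G) : set GT :=
  [set cosetT g | g in [set g : G | g0 + g *+ 2 \in T]]%classic.

Definition tau (g0 : G) (x : GT) : G := g0 + xi x *+ 2.

Record triple := Triple { tg0 : G; tkappa : GT -> nat; tsigma : GT -> int }.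

Definition in_X (p : triple) : Prop :=
  let: Triple g0 kappa sigma := p in
  [/\ exists x, kappa x <> 0%N,
      finite_set [set x | kappa x <> 0%N]%classic &
      forall x, kappa (- cosetT g0 - x) = kappa x] /\
  [/\ forall x, `|sigma x| <= (kappa x)%:Z,
      forall x, ~ GTsq g0 x -> sigma x = 0 &
      forall x, GTsq g0 x -> (sigma x = (kappa x)%:Z %[mod 2])%Z].

(* An admissible ordering of the support of kappa, with indices starting at   *)
(* 0: the first [nfix] elements lie in (G/T)_{g0} and the others form the     *)
(* [npair] consecutive pairs of indices nfix + 2l, nfix + 2l + 1.             *)
Record enumeration (p : triple) := Enumeration {
  nfix : nat;
  npair : nat;
  ox : 'I_(nfix + npair.*2) -> GT;
  ox_inj : injective ox;
  ox_supp : forall x, tkappa p x <> 0%N <-> exists i, ox i = x;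
  ox_fix : forall i : 'I_(nfix + npair.*2), (i < nfix)%N -> GTsq (tg0 p) (ox i);
  ox_pair : forall (i j : 'I_(nfix + npair.*2)) (l : nat),
    i = (nfix + l.*2)%N :> nat -> j = (nfix + l.*2).+1 :> nat ->
    ox i + ox j = - cosetT (tg0 p) }.

(* The inverse of A, if it exists (and A otherwise); [invmx] is only          *)
(* available over commutative rings.                                          *)
Definition mxinv n (A : 'M[D]_n) : 'M[D]_n :=
  xget A [set B | A *m B = 1%:M /\ B *m A = 1%:M]%classic.

Section MatrixAlgebra.
Variables (p : triple) (o : enumeration p).
Local Notation I := 'I_(nfix o + (npair o).*2).

Definition bsize (i : I) : nat := tkappa p (ox i).
Definition msize : nat := (\sum_(i < nfix o + (npair o).*2) bsize i)%N.

(* The component of degree h is spanned by the E_ab (x) d where E_ab is a     *)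
(* matrix unit in the (i, j) block, d is in D_t and g_i t g_j^-1 = h.         *)
Definition mx_comp (h : G) : set 'M[D]_msize :=
  [set A : 'M[D]_msize | forall a b : 'I_msize, exists2 t : G,
     xi (ox (tagnat.sig1 a)) + t - xi (ox (tagnat.sig1 b)) = h &
     A a b \in Dg t]%classic.

Definition npos (x : GT) : nat :=
  `|(((tkappa p x)%:Z + tsigma p x) %/ 2)%Z|%N.

(* The column of the only nonzero block in the block row i of Phi.            *)
Definition mate (i : nat) : nat :=
  if (i < nfix o)%N then i else if odd (i - nfix o) then i.-1 else i.+1.

(* X_t diag(I_p, - I_q) with p + q = kappa(x_i) on the block (i, i) for       *)
(* i < nfix; X_t I on the two nonzero blocks of each pair, which are square   *)
(* as kappa takes the same value at both elements of the pair.                *)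
Definition Phi_block (i j : I) : 'M[D]_(bsize i, bsize j) :=
  \matrix_(a < bsize i, b < bsize j)
    if (j == mate i :> nat) && (a == b :> nat) then
      if (i < nfix o)%N then
        (if (a < npos (ox i))%N then 1 else -1) * X (tau (tg0 p) (ox i))
      else X (tg0 p + xi (ox i) + xi (ox j))
    else 0.

Definition Phi : 'M[D]_msize :=
  \mxblock_(i < nfix o + (npair o).*2, j < nfix o + (npair o).*2) Phi_block i j.

(* The involution A |-> Phi^-1 phi0(A^T) Phi.                                 *)
Definition mx_inv (A : 'M[D]_msize) : 'M[D]_msize :=
  mxinv Phi *m map_mx phi0 A^T *m Phi.

End MatrixAlgebra.

Arguments mx_comp [p] o h.
Arguments mx_inv [p] o A.

(* M(D, phi0, p, 1) and M(D, phi0, p', 1), built with the enumerations o and  *)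
(* o', are isomorphic as graded R-algebras with involution. The scalar a in R *)
(* acts on matrices over D as a%:A : D.                                       *)
Definition M_iso (p p' : triple) (o : enumeration p) (o' : enumeration p') :=
  exists f : {rmorphism 'M[D]_(msize o) -> 'M[D]_(msize o')},
  [/\ bijective f,
      forall (a : R) A, f (a%:A *: A) = a%:A *: f A,
      forall h A, mx_comp o h A <-> mx_comp o' h (f A) &
      forall A, f (mx_inv o A) = mx_inv o' (f A)].

Definition act_sign (eps : int) (p : triple) : triple :=
  Triple (tg0 p) (tkappa p) (fun x => eps * tsigma p x).

Definition act (g : G) (p : triple) : triple :=
  Triple (tg0 p - g *+ 2)
    (fun x => tkappa p (x - cosetT g))
    (fun x =>
       let y := x - cosetT g in
       let t := tau (tg0 p) y in
       let u := - xi y - g + xi x in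
       sgD ((X (t + u *+ 2))^-1 * X u * X t * X u) * tsigma p y).

Definition same_orbit (p p' : triple) : Prop :=
  exists (g : G) (eps : int), (eps = 1 \/ eps = -1) /\
    p' = act g (act_sign eps p).

(* nu is a function T -> {+1, -1}; its values outside T are irrelevant.       *)
Definition is_quad (nu : G -> int) : Prop :=
  (forall t, t \in T -> nu t = 1 \/ nu t = -1) /\
  (forall s t, s \in T -> t \in T ->
     (nu (s + t))%:~R = (nu s * nu t)%:~R * beta s t).

Definition nu_twist (nu : G -> int) (p : triple) : triple :=
  Triple (tg0 p) (tkappa p)
    (fun x => nu (tau (tg0 p) x) * tsigma p x).

End Setup.

(* Main.v *)
(* A graded isomorphism f of the matrix algebras maps a diagonal matrix unit  *)
(* to an idempotent v l with l v = 1, v and l homogeneous; this writes        *)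
(* f A = P psi(A) Q with P = Q^-1 homogeneous and psi a graded automorphism   *)
(* of D. On the center C, psi is the identity or the conjugation. In the      *)
(* first case psi is conjugation by a homogeneous element (Skolem-Noether),   *)
(* which P and Q absorb. In the second case beta is real, hence +-1, so T is  *)
(* an elementary 2-group, and psi differs by such a conjugation from the      *)
(* automorphism X_t |-> nu(t) X_t extending the conjugation. The involutions  *)
(* then correspond iff Q^* c(Phi) Q is a nonzero real multiple of Phi', where *)
(* c is the identity or the nu-automorphism. Degrees give the relation        *)
(* between g_0 and g_0', invertibility of the blocks of Q the one between     *)
(* kappa and kappa', and Sylvester's law of inertia the one between the       *)
(* signatures. Conversely these relations let one choose Q monomial.          *)

From HB Require Import structures.
Require Import Defs.
From mathcomp Require Import all_boot all_order all_algebra all_field.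
From mathcomp Require Import boolp classical_sets reals complex.
From mathcomp Require Import ring zify.

Set Implicit Arguments.
Unset Strict Implicit.
Unset Printing Implicit Defensive.

Import Order.TTheory GRing.Theory Num.Theory.
Import VectorInternalTheory.
Local Open Scope ring_scope.

(** * Preliminaries: identities in abelian groups, linear systems, matrix units *)

(** The involution on matrices is the adjunction for the hermitian form with matrix [Phi], so the
    theorem asks when two such forms agree up to a change of homogeneous basis, a real factor and an
    automorphism of D.

    By [graded_iso_factor] an isomorphism is A |-> P psi(A) Q with P, Q homogeneous and mutually
    inverse. On C, psi is the identity or the conjugation ([psi_cst]). By [skolem_noether] P and Q
    can be changed so that psi becomes a standard automorphism c with the same restriction to C: the
    identity, or the one of [sign_twist_conj], which multiplies X_t by nu(t). The second case forces
    T to be an elementary 2-group ([conj_elementary2]), whence the two cases of the theorem. Since a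
    form is determined by its adjunction up to a central scalar, compatibility with the involutions
    means Q^* c(Phi) Q = r Phi' with r real and nonzero: this is [gram_rel] ([iso_gram_rel],
    [gram_M_iso]).

    Degrees force Q to join the block x only to the block x - g, and each D_t is the complex line of
    X_t, so each block of Q is a complex matrix. A block fixed by x |-> - g0 - x carries a complex
    hermitian form, whose invariant besides the rank is the signature; two blocks exchanged by this
    map carry a hyperbolic form, whose only invariant is the rank. Moving a block by g replaces X_t
    by X_u X_t X_u, a real multiple of X_(t + 2u) ([twist_factor]); its sign is the one in the
    action of G, the sign of r is epsilon, and c contributes nu(t). This gives [gram_degree],
    [gram_kappa] and [gram_sigma], and conversely [monomial_gram]. *)

Inductive zexpr := ZVar of nat | ZZero | ZAdd of zexpr & zexpr | ZOpp of zexpr.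

Fixpoint zeval (V : zmodType) (env : seq V) (e : zexpr) : V :=
  match e with
  | ZVar k => nth 0 env k
  | ZZero => 0
  | ZAdd e1 e2 => zeval env e1 + zeval env e2
  | ZOpp e1 => - zeval env e1
  end.

Fixpoint zcoef (e : zexpr) (i : nat) : int :=
  match e with
  | ZVar k => (k == i)%:R
  | ZZero => 0
  | ZAdd e1 e2 => zcoef e1 i + zcoef e2 i
  | ZOpp e1 => - zcoef e1 i
  end.

Lemma zevalE (V : zmodType) (env : seq V) e :
  zeval env e = \sum_(i < size env) env`_i *~ zcoef e i.
Proof.
elim: e => /= [k||e1 -> e2 ->|e ->].
- have [kn|nk] := ltnP k (size env).
    rewrite (bigD1 (Ordinal kn)) //= eqxx mulr1z big1 ?addr0 // => i ik.
    by rewrite -val_eqE /= eq_sym in ik; rewrite (negPf ik) mulr0z.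
  rewrite nth_default // big1 // => i _.
  by rewrite gtn_eqF ?mulr0z // (leq_trans (ltn_ord i)).
- by rewrite big1 // => i _; rewrite mulr0z.
- by rewrite -big_split; apply: eq_bigr => i _; rewrite mulrzDr.
- by rewrite -sumrN; apply: eq_bigr => i _; rewrite mulrNz.
Qed.

(** The reflection lemma behind [abel]: the integer coefficients of the atoms are compared by
    computation. *)
Lemma zeval_eq (V : zmodType) (env : seq V) e1 e2 :
  all (fun i => zcoef e1 i == zcoef e2 i) (iota 0 (size env)) ->
  zeval env e1 = zeval env e2.
Proof.
move=> /allP e12; rewrite !zevalE; apply: eq_bigr => i _.
by rewrite (eqP (e12 i _)) // mem_iota ltn_ord.
Qed.

(* Atoms are compared up to conversion: the same term may be built with
   different paths in the algebraic hierarchy. *)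
Ltac zidx x l :=
  lazymatch l with
  | ?y :: ?l' =>
    match constr:(tt) with
    | _ => let _ := constr:(erefl x : x = y) in constr:(O)
    | _ => let n := zidx x l' in constr:(S n)
    end
  end.
Ltac zadd x l :=
  match constr:(tt) with
  | _ => let _ := zidx x l in l
  | _ => constr:(x :: l)
  end.
Ltac zatoms t l :=
  lazymatch t with
  | @Algebra.add _ ?a ?b => let l := zatoms a l in zatoms b l
  | @Algebra.opp _ ?a => zatoms a l
  | @Algebra.zero _ => l
  | _ => zadd t l
  end.
Ltac zreify t l :=
  lazymatch t with
  | @Algebra.add _ ?a ?b =>
    let a := zreify a l in let b := zreify b l in constr:(ZAdd a b)
  | @Algebra.opp _ ?a => let a := zreify a l in constr:(ZOpp a)
  | @Algebra.zero _ => constr:(ZZero)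
  | _ => let n := zidx t l in constr:(ZVar n)
  end.
Ltac abel :=
  rewrite ?mulr2n;
  lazymatch goal with
  | |- @eq ?V ?a ?b =>
    let l := zatoms a (@nil V) in let l := zatoms b l in
    let ea := zreify a l in let eb := zreify b l in
    exact: (@zeval_eq _ l ea eb isT)
  end.


(** There are fewer equations, indexed by [A], than unknowns, indexed by [B]. This is the dimension
    count used to compare block sizes in [kappa_le] and signatures in [gram_cnt_le]. *)
Lemma underdetermined (F : fieldType) (I J : finType) (A : {set I}) (B : {set J})
    (q : I -> J -> F) : (#|A| < #|B|)%N ->
  exists v : J -> F, [/\ exists j, v j != 0, forall j, j \notin B -> v j = 0 &
    forall i, i \in A -> \sum_j q i j * v j = 0].
Proof.
move=> ltAB.
pose M : 'M[F]_(#|B|, #|A|) := \matrix_(j, i) q (enum_val i) (enum_val j).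
have : kermx M != 0.
  rewrite -mxrank_eq0 mxrank_ker subn_eq0 -ltnNge.
  exact: leq_ltn_trans (rank_leq_col M) _.
move=> /rowV0Pn[w /sub_kermxP wM w0].
have /rV0Pn[j0 wj0] : w != 0 := w0.
have j0B := enum_valP j0.
pose v j := if j \in B then w 0 (enum_rank_in j0B j) else 0.
exists v; split.
- by exists (enum_val j0); rewrite /v j0B enum_valK_in.
- by move=> j /negPf jB; rewrite /v jB.
move=> i iA; have /rowP/(_ (enum_rank_in iA i)) := wM.
rewrite !mxE => e; rewrite -[RHS]e (bigID (mem B)) /= [X in _ + X]big1 ?addr0; last first.
  by move=> j /negPf jB; rewrite /v jB mulr0.
rewrite (big_enum_val (fun j => q i j * v j)) /=; apply: eq_bigr => j _.
by rewrite mxE enum_rankK_in // mulrC /v enum_valP enum_valK_in.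
Qed.

Section MatrixUnits.
Variable S : nzRingType.

Definition emx m n (d : S) (a : 'I_m) (b : 'I_n) : 'M[S]_(m, n) :=
  \matrix_(i, j) if (i == a) && (j == b) then d else 0.

Lemma emx_mul m n k (d : S) (a : 'I_m) (b : 'I_n) (A : 'M_(n, k)) i j :
  (emx d a b *m A) i j = if i == a then d * A b j else 0.
Proof.
rewrite mxE (bigD1 b) //= mxE eqxx andbT big1 ?addr0 => [|l /negPf lb].
  by case: eqP; rewrite ?mul0r.
by rewrite mxE lb andbF mul0r.
Qed.

Lemma mul_emx m n k (A : 'M_(m, n)) (d : S) (a : 'I_n) (b : 'I_k) i j :
  (A *m emx d a b) i j = if j == b then A i a * d else 0.
Proof.
rewrite mxE (bigD1 a) //= mxE eqxx /= big1 ?addr0 => [|l /negPf la].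
  by case: eqP; rewrite ?mulr0.
by rewrite mxE la mulr0.
Qed.

Lemma emxM m n k (d d' : S) (a : 'I_m) (b c : 'I_n) (e : 'I_k) :
  emx d a b *m emx d' c e = if b == c then emx (d * d') a e else 0.
Proof.
apply/matrixP => i j; rewrite emx_mul !mxE; case: (b == c) => /=; rewrite !mxE.
  by case: (i == a); case: (j == e); rewrite ?mulr0.
by rewrite mulr0 if_same.
Qed.

Lemma emx_sandwich m n k l (A : 'M[S]_(m, n)) (d d' : S) (a : 'I_k) b c (e : 'I_l) :
  emx d a b *m A *m emx d' c e = emx (d * A b c * d') a e.
Proof.
apply/matrixP => i j; rewrite mul_emx emx_mul !mxE.
by case: (i == a); case: (j == e); rewrite ?mul0r.
Qed.

Lemma sum_emx n : \sum_(a < n) emx 1 a a = 1%:M :> 'M[S]_n.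
Proof.
apply/matrixP => i j; rewrite summxE mxE (bigD1 i) //= mxE eqxx /= big1 ?addr0.
  by rewrite eq_sym; case: eqP.
by move=> l /negPf li; rewrite mxE eq_sym li.
Qed.

Lemma emx_eq0 m n (d : S) (a : 'I_m) (b : 'I_n) : (emx d a b == 0) = (d == 0).
Proof.
apply/eqP/eqP => [/matrixP/(_ a b)|->]; first by rewrite !mxE !eqxx.
by apply/matrixP => i j; rewrite !mxE if_same.
Qed.

Lemma emxD m n (d d' : S) (a : 'I_m) (b : 'I_n) :
  emx (d + d') a b = emx d a b + emx d' a b.
Proof. by apply/matrixP => i j; rewrite !mxE; case: ifP; rewrite ?addr0. Qed.

Lemma scale_emx m n (c d : S) (a : 'I_m) (b : 'I_n) :
  emx (c * d) a b = c *: emx d a b.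
Proof. by apply/matrixP => i j; rewrite !mxE; case: ifP; rewrite ?mulr0. Qed.

(** Commutation is tested on the matrix units [emx d a b]. *)
Lemma central_mx n (Z : 'M[S]_n) (i0 : 'I_n) :
  (forall B, Z *m B = B *m Z) ->
  Z = (Z i0 i0)%:M /\ forall d, Z i0 i0 * d = d * Z i0 i0.
Proof.
move=> ZB; have ZE i a d b : Z i a * d = if i == a then d * Z b b else 0.
  have /matrixP/(_ i b) := ZB (emx d a b).
  by rewrite mul_emx emx_mul eqxx.
split=> [|d]; last by rewrite (ZE i0 i0 d i0) eqxx.
apply/matrixP => i a; have := ZE i a 1 i0; rewrite mulr1 mul1r => ->.
by rewrite mxE; case: eqP.
Qed.

Lemma monomial_inv m n (s : 'I_n -> 'I_m) (s' : 'I_m -> 'I_n) (d e : 'I_n -> S)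
    (A := \matrix_(b, a) if b == s a then d a else 0)
    (B := \matrix_(a, b) if b == s a then e a else 0) :
  cancel s s' -> cancel s' s -> (forall a, d a * e a = 1) ->
  (forall a, e a * d a = 1) -> A *m B = 1%:M /\ B *m A = 1%:M.
Proof.
move=> sK s'K de ed; split; apply/matrixP => i j; rewrite !mxE.
  rewrite (bigD1 (s' i)) //= !mxE s'K eqxx big1 ?addr0.
    by rewrite [j == i]eq_sym; case: eqP => [_|]; rewrite ?mulr0 // de.
  move=> a ai; rewrite mxE; case: eqP => [ia|]; rewrite ?mul0r //.
  by rewrite ia sK eqxx in ai.
rewrite (bigD1 (s i)) //= !mxE eqxx big1 ?addr0.
  by rewrite (can_eq sK); case: eqP => [<-|]; rewrite ?mulr0 // ed.
by move=> b /negPf bi; rewrite mxE bi mul0r.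
Qed.

End MatrixUnits.

Section Classification.
Variables (R : realType) (G : zmodType) (D : grDivAlg R G).
Local Notation T := (supp D).
Local Notation Dg := (gr_comp D).

(** * Homogeneous components *)

Lemma gr_mem_supp t d : d \in Dg t -> d != 0 -> t \in T.
Proof. by move=> dD d0; apply/suppP; exists d. Qed.

Lemma gr_cast s t d : d \in Dg s -> s = t -> d \in Dg t.
Proof. by move=> dD <-. Qed.

(** For distinct degrees, [d] and [- d] would be a nontrivial relation between two independent
    components. *)
Lemma gr_disjoint s t d : d \in Dg s -> d \in Dg t -> d != 0 -> s = t.
Proof.
move=> ds dt; apply: contra_neq_eq => st.
pose g (i : 'I_2) := if i == ord0 then s else t.
have g_inj : injective g.
  have st' : (t == s) = false by rewrite eq_sym (negPf st).
  move=> [[|[|i]] i2] [[|[|j]] j2] //=; rewrite /g /= => /eqP;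
    rewrite ?(negPf st) ?st' // => _; exact: val_inj.
pose u (i : 'I_2) := if i == ord0 then d else - d.
have uD i : true -> u i \in Dg (g i).
  by rewrite /u /g; case: ifP; rewrite ?rpredN.
have u0 : \sum_i u i = 0 by rewrite big_ord_recl big_ord1 /u /= subrr.
exact: (elimT directv_sum_independent (gr_direct _ g_inj) u uD u0 ord0 isT).
Qed.

Lemma gr_mulf_neq0 s t x y :
  x \in Dg s -> y \in Dg t -> x != 0 -> y != 0 -> x * y != 0.
Proof.
move=> xD yD x0 y0; have ux := gr_unit xD x0.
by rewrite mulrI_eq0 //; apply: mulrI.
Qed.

Lemma gr_decomp d : exists (n : nat) (g : 'I_n -> G) (u : 'I_n -> D),
  (forall i, u i \in Dg (g i)) /\ d = \sum_i u i.
Proof.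
have [n [g gE]] := gr_span D.
have /memv_sumP[u uD ->] : d \in (\sum_(i < n) Dg (g i))%VS by rewrite gE memvf.
by exists n, g, u; split=> // i; apply: uD.
Qed.

Lemma gr_eq_lin (phi psi : D -> D) :
  (forall x y, phi (x + y) = phi x + phi y) ->
  (forall x y, psi (x + y) = psi x + psi y) ->
  (forall t d, d \in Dg t -> phi d = psi d) -> phi =1 psi.
Proof.
move=> phiD psiD e d.
have f0 (f : D -> D) : (forall x y, f (x + y) = f x + f y) -> f 0 = 0.
  by move=> fD; apply: (addrI (f 0)); rewrite -fD !addr0.
have [n [g [u [uD ->]]]] := gr_decomp d.
rewrite (big_morph phi phiD (f0 _ phiD)) (big_morph psi psiD (f0 _ psiD)).
by apply: eq_bigr => i _; apply: e (uD i).
Qed.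


(** Otherwise the component of degree [t] could be adjoined to the family, and its nonzero elements
    would also be sums of elements of the other components. *)
Lemma span_supp n (g : 'I_n -> G) t : injective g ->
  (\sum_(i < n) Dg (g i))%VS = fullv -> t \in T -> exists i, g i = t.
Proof.
move=> g_inj gE /suppP[x xD x0]; apply: contrapT => gt.
have /memv_sumP[y yD yE] : x \in (\sum_(i < n) Dg (g i))%VS.
  by rewrite gE memvf.
pose h (i : 'I_n.+1) := oapp g t (unlift ord0 i).
pose u (i : 'I_n.+1) := oapp y (- x) (unlift ord0 i).
have h_inj : injective h.
  move=> i j; rewrite /h; case: unliftP => [i'|] ->; case: unliftP => [j'|] -> //=.
  - by move=> /g_inj ->.
  - by move=> e; case: gt; exists i'.
  - by move=> e; case: gt; exists j'.
have uD i : true -> u i \in Dg (h i).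
  rewrite /u /h; case: unliftP => [j|] _ _ /=; first exact: yD.
  by rewrite rpredN.
have u0 : \sum_i u i = 0.
  rewrite big_ord_recl [u ord0]/u unlift_none /= [in - x]yE addrC.
  by under eq_bigr do rewrite /u liftK /=; rewrite subrr.
have := elimT directv_sum_independent (gr_direct _ h_inj) u uD u0 ord0 isT.
by rewrite /u unlift_none => /eqP; rewrite oppr_eq0 (negPf x0).
Qed.

Lemma supp_finite : exists2 s : seq G, uniq s & s =i T.
Proof.
have [n [g [g_inj gE]]] := gr_span_inj D.
exists [seq t <- codom g | t \in T].
  by rewrite filter_uniq // map_inj_uniq // enum_uniq.
move=> t; rewrite mem_filter; apply: andb_idr => /(span_supp g_inj gE)[i <-].
exact: codom_f.
Qed.

(** A combination of the projections of the direct sum, with coefficients [nu (g i)]. *)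
Lemma gr_scaling (nu : G -> R) : exists N : {linear D -> D},
  forall t d, d \in Dg t -> N d = nu t *: d.
Proof.
have [n [g [g_inj gE]]] := gr_span_inj D.
have dir := gr_direct D g_inj.
pose N : 'End(D) := \sum_i nu (g i) *: sumv_pi_for (esym gE) i.
exists N => t d dD.
have [->|d0] := eqVneq d 0; first by rewrite linear0 scaler0.
have [i0 gi0] := span_supp g_inj gE (gr_mem_supp dD d0).
have pE i : sumv_pi_for (esym gE) i d = (if i == i0 then d else 0).
  pose u i := (if i == i0 then d else 0).
  have uD i1 : true -> u i1 \in Dg (g i1).
    by move=> _; rewrite /u; case: eqP => [->|]; rewrite ?gi0 ?mem0v.
  have vD i1 : true -> sumv_pi_for (esym gE) i1 d \in Dg (g i1).
    by move=> _; apply: memv_sum_pi.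
  have := elimT directv_sum_unique dir _ _ vD uD.
  rewrite sumv_pi_sum ?memvf // /u -big_mkcond big_pred1_eq eqxx.
  by move/esym/forallP/(_ i) => /eqP.
rewrite /= /N sum_lfunE (bigD1 i0) //= scale_lfunE pE eqxx gi0 big1 ?addr0 //.
by move=> i /negPf ii0; rewrite scale_lfunE pE ii0 scaler0.
Qed.

(** * The identity component is the center *)

Variable iota : {lrmorphism Rcomplex R -> D}.
Hypothesis center_C : iso_center iota.
Hypothesis center_triv : ('Z({:D}) <= gr_comp D 0)%VS.

Definition cst (z : R[i]) : D := iota z.

Lemma cstD z w : cst (z + w) = cst z + cst w. Proof. exact: (rmorphD iota). Qed.
Lemma cstN z : cst (- z) = - cst z. Proof. exact: (rmorphN iota). Qed.
Lemma cst0 : cst 0 = 0. Proof. exact: (rmorph0 iota). Qed.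
Lemma cst1 : cst 1 = 1. Proof. exact: (rmorph1 iota). Qed.
Lemma cstM z w : cst (z * w) = cst z * cst w. Proof. exact: (rmorphM iota). Qed.
Lemma cstR (a : R) : cst (a%:C)%C = a%:A.
Proof.
rewrite -cst1 /cst -linearZ; congr (iota _).
by apply/eqP; rewrite eq_complex /= mulr1 mulr0 !eqxx.
Qed.
Lemma cst_sum I (r : seq I) (P : pred I) (F : I -> R[i]) :
  cst (\sum_(i <- r | P i) F i) = \sum_(i <- r | P i) cst (F i).
Proof. exact: (big_morph _ cstD cst0). Qed.
Lemma cst_eq0 z : (cst z == 0) = (z == 0).
Proof.
apply/eqP/eqP => [|->]; last exact: cst0.
by rewrite -cst0; apply: (proj1 center_C).
Qed.

Lemma cst_comm z d : cst z * d = d * cst z.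
Proof.
have /(proj2 center_C) : exists w, iota w = cst z by exists z.
by rewrite memv_cap => /andP[_ /centvP->//]; apply: memvf.
Qed.

Lemma cst_mulACA z w x y : (cst z * x) * (cst w * y) = cst (z * w) * (x * y).
Proof. by rewrite mulrA -[cst z * x * _]mulrA -[x * cst w]cst_comm cstM !mulrA. Qed.

Lemma cst_gr z : cst z \in Dg 0.
Proof. by apply: (subvP center_triv); apply/(proj2 center_C); exists z. Qed.

Lemma cst_gr_mul t z d : d \in Dg t -> cst z * d \in Dg t.
Proof. by move=> dD; have := gr_mul (cst_gr z) dD; rewrite add0r. Qed.

Lemma cst_unit z : z != 0 -> cst z \is a GRing.unit.
Proof. by move=> z0; apply: gr_unit (cst_gr z) _; rewrite cst_eq0. Qed.

Lemma cstV z : cst z^-1 = (cst z)^-1.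
Proof.
have [->|z0] := eqVneq z 0; first by rewrite invr0 cst0 invr0.
by apply: (mulrI (cst_unit z0)); rewrite -cstM mulfV ?mulrV ?cst1 ?cst_unit.
Qed.

Lemma center_cst d : (forall x, d * x = x * d) -> exists z, d = cst z.
Proof.
move=> dx; have /(proj2 center_C)[z <-] : d \in 'Z({:D})%VS.
  by rewrite memv_cap memvf; apply/centvP => x _.
by exists z.
Qed.

(** The first [dim D + 1] powers of [d] are linearly dependent over [R]. *)
Lemma algebraic_elt (d : D) : exists2 q : {poly R}, q != 0 &
  \sum_(i < size q) q`_i *: d ^+ i = 0.
Proof.
pose n := dim D.
pose A := \matrix_(i < n.+1) v2r (d ^+ i).
have : kermx A != 0.
  rewrite -mxrank_eq0 mxrank_ker subn_eq0 -ltnNge.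
  exact: leq_ltn_trans (rank_leq_col A) _.
move=> /rowV0Pn[v /sub_kermxP vA v0].
pose q := \poly_(i < n.+1) v 0 (inord i).
have qE (i : 'I_n.+1) : q`_i = v 0 i by rewrite coef_poly ltn_ord inord_val.
exists q.
  apply: contra_neq v0 => q0; apply/rowP => i.
  by rewrite -qE q0 coef0 mxE.
have szq : (size q <= n.+1)%N by apply: size_poly.
rewrite (big_ord_widen _ (fun i => q`_i *: d ^+ i) szq) big_mkcond /=.
apply: (can_inj (@v2rK _ _)); rewrite linear0 -vA mulmx_sum_row linear_sum.
apply: eq_bigr => i _; rewrite rowK.
case: ifP => [_|/negbT]; first by rewrite linearZ qE.
by rewrite -leqNgt => szi; rewrite linear0 -qE nth_default // scale0r.
Qed.

(** A real polynomial annihilating [d] splits over C. Each factor [d - cst z] is homogeneous of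
    degree 0, hence zero or invertible; as the product vanishes, one factor does. *)
Lemma gr0_cst d : d \in Dg 0 -> exists z, d = cst z.
Proof.
move=> dD; have [q q0 qd] := algebraic_elt d.
pose F (p : {poly R[i]}) := \sum_(i < size p) cst p`_i * d ^+ i.
have FE n (p : {poly R[i]}) : (size p <= n)%N ->
    F p = \sum_(i < n) cst p`_i * d ^+ i.
  move=> szp; rewrite /F (big_ord_widen _ (fun i => cst p`_i * d ^+ i) szp).
  rewrite big_mkcond; apply: eq_bigr => i _.
  by case: ifP => // /negbT; rewrite -leqNgt => /(nth_default 0) ->; rewrite cst0 mul0r.
pose qC := map_poly (real_complex R) q.
have qC0 : qC != 0 by rewrite map_poly_eq0.
have FqC : F qC = 0.
  rewrite /F size_map_poly -[RHS]qd; apply: eq_bigr => i _.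
  by rewrite coef_map /= cstR mulr_algl.
have [r rE] := closed_field_poly_normal qC.
(* Evaluation [F] at [d] is multiplicative on linear factors because the coefficients are
   central. *)
have FM (a : R[i]) p : F (('X - a%:P) * p) = (d - cst a) * F p.
  pose n := (size p).+2.
  rewrite (FE n); last first.
    by rewrite (leq_trans (size_polyMleq _ _)) // size_XsubC /n /= addSn.
  rewrite [RHS]mulrBl {1}(FE (size p).+1) // (FE n) //; last by rewrite /n ltnW.
  under eq_bigr => i _ do rewrite mulrBl coefB coefXM coefCM cstD cstN mulrBl.
  rewrite sumrB; congr (_ - _); last first.
    by rewrite mulr_sumr; apply: eq_bigr => i _; rewrite cstM mulrA.
  rewrite /n big_ord_recl /= cst0 mul0r add0r mulr_sumr.
  by apply: eq_bigr => i _; rewrite exprS !mulrA cst_comm.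
have Fr (s : seq R[i]) : F (\prod_(z <- s) ('X - z%:P)) = \prod_(z <- s) (d - cst z).
  elim: s => [|z s IH]; last by rewrite !big_cons FM IH.
  by rewrite !big_nil /F size_poly1 big_ord1 coef1 cst1 mul1r expr0.
have FZ (a : R[i]) p : a != 0 -> F (a *: p) = cst a * F p.
  move=> a0; rewrite /F size_scale // mulr_sumr; apply: eq_bigr => i _.
  by rewrite coefZ cstM mulrA.
have lC0 : lead_coef qC != 0 by rewrite lead_coef_eq0.
have {}Fr : \prod_(z <- r) (d - cst z) = 0.
  apply: (mulrI (cst_unit lC0)); rewrite mulr0 -Fr -FZ // -rE.
  exact: FqC.
elim: r {rE} Fr => [|z r IH]; first by rewrite big_nil => /eqP; rewrite oner_eq0.
rewrite big_cons; have [/eqP|dz] := eqVneq (d - cst z) 0.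
  by rewrite subr_eq0 => /eqP -> _; exists z.
move=> e; apply: IH; apply: (@mulrI _ (d - cst z)); last by rewrite mulr0.
by apply: (@gr_unit _ _ D 0) => //; apply: rpredB => //; apply: cst_gr.
Qed.

(** A nonzero [y] of degree [- t] exists, and [d * y] is a nonzero scalar by [gr0_cst]; so the
    inverse of [d] is a scalar multiple of [y]. *)
Lemma gr_inv t d : d \in Dg t -> d != 0 -> d^-1 \in Dg (- t).
Proof.
move=> dD d0; have ud := gr_unit dD d0.
have /suppP[y yD y0] : - t \in T by apply: supp_opp; apply: gr_mem_supp dD d0.
have := gr_mul dD yD; rewrite subrr => /gr0_cst[z zE].
have z0 : z != 0 by rewrite -cst_eq0 -zE (gr_mulf_neq0 dD yD).
have -> : d^-1 = cst z^-1 * y; last exact: cst_gr_mul.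
apply: (mulrI ud); rewrite mulrV // mulrA -cst_comm -mulrA zE cstV mulVr //.
exact: cst_unit.
Qed.

(** * The involution and the elements X_t *)

Variables (phi0 : {linear D -> D}) (X : G -> D).
Hypothesis phi0_inv : is_involution phi0.
Hypothesis phi0_deg : forall t d, d \in gr_comp D t -> phi0 d \in gr_comp D t.
Hypothesis phi0_conj : forall z : R[i], phi0 (iota z) = iota (conjc z).
Hypothesis X_spec : forall t, t \in supp D ->
  [/\ X t != 0, X t \in gr_comp D t & phi0 (X t) = X t].

Let phi0M x y : phi0 (x * y) = phi0 y * phi0 x. Proof. exact: (proj1 phi0_inv). Qed.
Let phi0K x : phi0 (phi0 x) = x. Proof. exact: (proj2 phi0_inv). Qed.

Lemma X_gr t : t \in T -> X t \in Dg t. Proof. by case/X_spec. Qed.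
Lemma X_neq0 t : t \in T -> X t != 0. Proof. by case/X_spec. Qed.
Lemma X_unit t : t \in T -> X t \is a GRing.unit.
Proof. by move=> tT; apply: gr_unit (X_gr tT) (X_neq0 tT). Qed.
Lemma phi0_X t : t \in T -> phi0 (X t) = X t. Proof. by case/X_spec. Qed.
Lemma phi0_cst z : phi0 (cst z) = cst (conjc z). Proof. exact: phi0_conj. Qed.
Lemma phi0_1 : phi0 1 = 1.
Proof. by rewrite -cst1 phi0_cst rmorph1. Qed.

Lemma gr_line t d : t \in T -> d \in Dg t -> exists z, d = cst z * X t.
Proof.
move=> tT dD; have /(gr0_cst)[z zE] : d / X t \in Dg 0.
  have /(gr_mul dD) := gr_inv (X_gr tT) (X_neq0 tT).
  by rewrite subrr.
by exists z; rewrite -zE divrK // X_unit.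
Qed.

Lemma phi0_line t z : t \in T -> phi0 (cst z * X t) = cst (conjc z) * X t.
Proof. by move=> tT; rewrite phi0M phi0_cst phi0_X // cst_comm. Qed.

Lemma real_cst z : conjc z = z -> cst z = (complex.Re z)%:A.
Proof.
case: z => a b [] /eqP; rewrite -subr_eq0 -opprD oppr_eq0 -mulr2n mulrn_eq0 /=.
by move=> /eqP ->; rewrite -cstR.
Qed.

Lemma cst_inj_X t z w : t \in T -> cst z * X t = cst w * X t -> z = w.
Proof.
move=> tT /(mulIr (X_unit tT)) e; apply: (proj1 center_C); exact: e.
Qed.

(** Applying [phi0] to X_s X_t = b X_t X_s reverses the products and conjugates b, which gives |b| =
    1. The commutation rule passes from X_s and X_t to the lines they span over C. *)
Lemma beta_cst s t : s \in T -> t \in T -> exists b, [/\ beta X s t = cst b,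
  conjc b * b = 1 & forall x y, x \in Dg s -> y \in Dg t -> x * y = cst b * (y * x)].
Proof.
move=> sT tT.
have XstG : X s * X t \in Dg (s + t) by rewrite gr_mul ?X_gr.
have XtsG : X t * X s \in Dg (s + t) by rewrite addrC gr_mul ?X_gr.
have Xts0 : X t * X s != 0 by apply: (gr_mulf_neq0 (X_gr tT) (X_gr sT)); rewrite X_neq0.
have uXts : X t * X s \is a GRing.unit := gr_unit XtsG Xts0.
have /(gr0_cst)[b bE] : beta X s t \in Dg 0.
  by rewrite -(subrr (s + t)) gr_mul // gr_inv.
have XE : X s * X t = cst b * (X t * X s) by rewrite -bE divrK.
exists b; split=> // [|x y].
  apply: (proj1 center_C); apply: (mulIr uXts).
  rewrite -/(cst _) -/(cst 1) cst1 mul1r cstM -mulrA -XE.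
  have := congr1 phi0 XE; rewrite !phi0M phi0_cst !phi0_X // => ->.
  by rewrite -cst_comm.
move=> /(gr_line sT)[z ->] /(gr_line tT)[w ->].
by rewrite !cst_mulACA // XE !mulrA -!cstM mulrC [z * w]mulrC.
Qed.

Lemma real_line t d : t \in T -> d \in Dg t -> phi0 d = d -> exists a : R, d = a *: X t.
Proof.
move=> tT /(gr_line tT)[z ->]; rewrite phi0_line // => /cst_inj_X zz.
by exists (complex.Re z); rewrite (real_cst (zz tT)) mulr_algl.
Qed.

Lemma sgDE (a : R) : sgD (a%:A : D) = sgz a.
Proof.
rewrite /sgD; congr sgz; case: xgetP => [b ->|/(_ a)] //=.
by move/eqP; rewrite -subr_eq0 -scalerBl scaler_eq0 oner_eq0 orbF subr_eq0 => /eqP.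
Qed.

(** The palindrome X_u X_t X_u is fixed by [phi0], so it lies on the real line of X_(t + 2u). *)
Lemma twist_factor t u : t \in T -> u \in T ->
  exists a : R, [/\ a != 0, X u * X t * X u = a *: X (t + u *+ 2) &
    sgD ((X (t + u *+ 2))^-1 * X u * X t * X u) = sgz a].
Proof.
move=> tT uT; have tuT : t + u *+ 2 \in T by rewrite rpredD ?rpredMn.
have XutG : X u * X t \in Dg (u + t) by rewrite gr_mul ?X_gr.
have XutuG : X u * X t * X u \in Dg (t + u *+ 2).
  by rewrite mulr2n addrA [t + u]addrC gr_mul ?X_gr.
have [|a aE] := real_line tuT XutuG; first by rewrite !phi0M !phi0_X // mulrA.
exists a; split=> //.
  apply: contra_eq_neq aE => ->; rewrite scale0r.
  rewrite (gr_mulf_neq0 XutG (X_gr uT)) ?X_neq0 // (gr_mulf_neq0 (X_gr uT) (X_gr tT)) ?X_neq0 //.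
by rewrite -!mulrA [X u * _]mulrA aE -scalerAr mulVr ?X_unit // sgDE.
Qed.

(** * A graded Skolem-Noether theorem *)

Section SkolemNoether.
Variable th : D -> D.
Hypothesis thD : forall x y, th (x + y) = th x + th y.
Hypothesis thM : forall x y, th (x * y) = th x * th y.
Hypothesis th_cst : forall z, th (cst z) = cst z.

Definition average (s : seq G) d := \sum_(t <- s) th (X t) * d / X t.

(** Multiplication by a homogeneous element of degree r permutes the terms by t |-> r + t up to
    scalars. These cancel between [th (X t)] and the inverse of [X t], since [th] fixes the
    scalars. *)
Lemma average_comm (s : seq G) (d x : D) : uniq s -> s =i T ->
  average s d * x = th x * average s d.
Proof.
move=> us sT.
have th0 : th 0 = 0 by have := th_cst 0; rewrite cst0.
have hom r y : y \in Dg r -> average s d * y = th y * average s d.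
  move=> yD; have [->|y0] := eqVneq y 0; first by rewrite th0 mulr0 mul0r.
  have rT := gr_mem_supp yD y0; have uy := gr_unit yD y0.
  have ps : perm_eq s [seq r + t | t <- s].
    apply: uniq_perm => // [|t]; first by rewrite map_inj_uniq //; apply: addrI.
    rewrite sT; apply/idP/mapP => [tT|[t' t's ->]]; last by rewrite rpredD // -sT.
    by exists (t - r); rewrite ?sT ?rpredB // addrC subrK.
  rewrite /average [in LHS](perm_big _ ps) big_map /= mulr_suml mulr_sumr.
  apply: eq_big_seq => t; rewrite sT => tT.
  have rtT : r + t \in T by rewrite rpredD.
  have [z zE] := gr_line rtT (gr_mul yD (X_gr tT)).
  have z0 : z != 0.
    apply: contra_eq_neq zE => ->; rewrite cst0 mul0r.
    by rewrite (gr_mulf_neq0 yD (X_gr tT)) ?X_neq0.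
  have uz := cst_unit z0.
  have XE : X (r + t) = cst z^-1 * (y * X t) by rewrite zE mulrA -cstM mulVf // cst1 mul1r.
  rewrite -[LHS]mulrA; have -> : (X (r + t))^-1 * y = (X t)^-1 * cst z.
    rewrite XE invrM ?unitrMl ?X_unit // ?cstV // ?unitrV // invrK invrM ?X_unit //.
    by rewrite -!mulrA cst_comm mulKr.
  rewrite XE !thM th_cst !mulrA.
  by rewrite -[LHS]cst_comm !mulrA -cstM mulfV // cst1 !mul1r.
apply: (gr_eq_lin (phi := fun x => average s d * x) (psi := fun x => th x * average s d)).
- by move=> y z; rewrite mulrDr.
- by move=> y z; rewrite thD mulrDl.
- by move=> t y; apply: hom.
Qed.

End SkolemNoether.


Lemma natr_falg (n : nat) : (n%:R == 0 :> D) = (n == 0)%N.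
Proof. by rewrite -scaler_nat scaler_eq0 oner_eq0 orbF pnatr_eq0. Qed.

(** The conjugating element is any nonzero average of some X_u, which is homogeneous of degree u. If
    all these averages vanished, so would their sum after right division by X_u; but exchanging the
    two summations shows that this sum is the order of T, which is nonzero in characteristic 0. *)
Lemma skolem_noether (th : D -> D) :
  (forall x y, th (x + y) = th x + th y) ->
  (forall x y, th (x * y) = th x * th y) ->
  (forall t d, d \in Dg t -> th d \in Dg t) ->
  (forall z, th (cst z) = cst z) ->
  exists u y, [/\ y \in Dg u, y != 0 & forall d, th d * y = y * d].
Proof.
move=> thD thM th_gr th_cst; have [s us sT] := supp_finite.
have [/hasP[u uS Nu]|/hasPn N0] := boolP (has (fun u => average th s (X u) != 0) s).
  rewrite sT in uS; exists u, (average th s (X u)); split=> // [|d].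
    rewrite /average big_seq; apply: rpred_sum => t; rewrite sT => tT.
    have := gr_mul (gr_mul (th_gr _ _ (X_gr tT)) (X_gr uS)) (gr_inv (X_gr tT) (X_neq0 tT)).
    by rewrite addrAC subrr add0r.
  by rewrite (average_comm thD thM th_cst).
(* The inner sum over u of X_u X_t^-1 X_u^-1 is central of degree - t, hence
   vanishes unless t = 0. *)
have tot : \sum_(u <- s) average th s (X u) / X u = (size s)%:R; last first.
  move: tot; rewrite big_seq big1 => [/esym/eqP|u /N0]; last first.
    by rewrite negbK => /eqP ->; rewrite mul0r.
  have : 0 \in s by rewrite sT rpred0.
  by rewrite natr_falg; case: (s).
have zero t : t \in T -> t != 0 -> average id s (X t)^-1 = 0.
  move=> tT t0; have ctr x : average id s (X t)^-1 * x = x * average id s (X t)^-1.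
    exact: (average_comm (th := id)).
  apply: contraNeq t0 => av0.
  have [z zE] := center_cst ctr.
  rewrite -oppr_eq0; apply/eqP; apply: (gr_disjoint _ _ av0); last first.
    by rewrite zE cst_gr.
  rewrite /average big_seq; apply: rpred_sum => u; rewrite sT => uT.
  have := gr_mul (gr_mul (X_gr uT) (gr_inv (X_gr tT) (X_neq0 tT))) (gr_inv (X_gr uT) (X_neq0 uT)).
  by rewrite addrAC subrr add0r.
under eq_bigr do rewrite /average mulr_suml.
rewrite exchange_big /=.
have -> : \sum_(t <- s) \sum_(u <- s) th (X t) * X u / X t / X u =
    \sum_(t <- s) th (X t) * average id s (X t)^-1.
  apply: eq_bigr => t _; rewrite /average mulr_sumr.
  by apply: eq_bigr => u _; rewrite !mulrA.
have s0 : 0 \in s by rewrite sT rpred0.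
rewrite (bigD1_seq 0) //= big_seq_cond big1 ?addr0; last first.
  by move=> t /andP[ts t0]; rewrite zero ?mulr0 // -sT.
have [z zE] := gr0_cst (X_gr (rpred0 T)).
rewrite zE th_cst /average -cstV // big_seq.
under eq_bigr => u uS do rewrite -cst_comm mulrK ?X_unit -?sT //.
rewrite -big_seq big_const_seq count_predT iter_addr_0 mulrnAr -cstM mulfV ?cst1 //.
by rewrite -(cst_eq0) -zE X_neq0 ?rpred0.
Qed.

(** * Graded automorphisms of D *)

(** Covers both standard automorphisms at once: the identity with [mu] = 1, and the extension of the
    conjugation with [mu] = [nu]. *)
Definition sign_twist (mu : G -> int) (c : D -> D) : Prop :=
  [/\ forall t d, d \in Dg t -> c d \in Dg t,
      forall d, c (c d) = d,
      forall d, c (phi0 d) = phi0 (c d),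
      forall (a : R) d, c (a *: d) = a *: c d &
      forall t, t \in T ->
        c (X t) = (mu t)%:~R * X t /\ (mu t = 1 \/ mu t = -1)].

Lemma sign_twist_id : sign_twist (fun=> 1) idfun.
Proof. by split=> // t _; rewrite mul1r; split=> //; left. Qed.

Lemma sign_twist_conj (nu : G -> int) : is_quad X nu ->
  exists c : {rmorphism D -> D},
    sign_twist nu c /\ forall z, c (cst z) = cst (conjc z).
Proof.
move=> [nu1 nuM]; have [N NE] := gr_scaling (fun t => (nu t)%:~R).
have nu2 t : t \in T -> (nu t)%:~R * (nu t)%:~R = 1 :> R.
  by case/nu1 => ->; rewrite ?mulr1 // mulrNN mulr1.
have nuG t d : d \in Dg t -> d = 0 \/ t \in T.
  by move=> dD; have [->|/(gr_mem_supp dD)] := eqVneq d 0; [left | right].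
(* The value -1 would contradict nu(0) = nu(0)^2 beta(0, 0) = 1. It follows that [c0] is [phi0],
   hence the conjugation, in degree 0. *)
have nu0 : nu 0 = 1.
  have := nuM 0 0 (rpred0 _) (rpred0 _); rewrite addr0 /beta (@divrr _ (X 0 * X 0)); last first.
    by rewrite unitrMl X_unit ?rpred0.
  case: (nu1 0 (rpred0 _)) => -> //; rewrite mulrNN mulr1 mulr1.
  move/eqP; rewrite eq_sym -subr_eq0 opprK -[1 + 1]/(2%:R) (natr_falg 2).
  by [].
(* N is an antiautomorphism because nu is a quadratic form for beta, so that
   phi0 N is an automorphism. *)
pose c0 d := phi0 (N d).
have c0D x y : c0 (x + y) = c0 x + c0 y by rewrite /c0 !linearD.
have c0E t d : d \in Dg t -> c0 d = (nu t)%:~R *: phi0 d.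
  by move=> dD; rewrite /c0 (NE _ _ dD) linearZ.
have c0M x y : c0 (x * y) = c0 x * c0 y.
  apply: (gr_eq_lin (phi := fun y => c0 (x * y)) (psi := fun y => c0 x * c0 y)).
  - by move=> {}y z; rewrite mulrDr c0D.
  - by move=> {}y z; rewrite c0D mulrDr.
  move=> t {}y yD.
  apply: (gr_eq_lin (phi := fun x => c0 (x * y)) (psi := fun x => c0 x * c0 y)).
  - by move=> {}x z; rewrite mulrDl c0D.
  - by move=> {}x z; rewrite c0D mulrDl.
  move=> s {}x xD.
  have c00 : c0 0 = 0 by rewrite /c0 !linear0.
  have [->|sT] := nuG _ _ xD; first by rewrite mul0r c00 mul0r.
  have [->|tT] := nuG _ _ yD; first by rewrite mulr0 c00 mulr0.
  rewrite (c0E _ _ (gr_mul xD yD)) (c0E _ _ xD) (c0E _ _ yD) phi0M.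
  have [b [bE b1 bX]] := beta_cst sT tT.
  have xyE := bX _ _ (phi0_deg xD) (phi0_deg yD).
  rewrite -scalerAl -scalerAr scalerA xyE -[LHS]mulr_algl [RHS]scalerAl.
  by congr (_ * _); rewrite scaler_int nuM // bE -intrM scaler_int mulrzl.
have c01 : c0 1 = 1.
  by rewrite (c0E _ _ (gr_one D)) nu0 scale1r (phi0_1).
have c0K d : c0 (c0 d) = d.
  apply: (gr_eq_lin (phi := fun d => c0 (c0 d)) (psi := id)) => //.
    by move=> x y; rewrite !c0D.
  move=> t {}d dD; have [->|tT] := nuG _ _ dD; first by rewrite /c0 !linear0.
  rewrite (c0E _ _ dD) /c0 !linearZ /= -/(c0 _) (c0E _ _ (phi0_deg dD)).
  by rewrite scalerA nu2 // scale1r phi0K.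
have c0G t d : d \in Dg t -> c0 d \in Dg t.
  by move=> dD; rewrite (c0E _ _ dD) rpredZ // phi0_deg.
have c0P d : c0 (phi0 d) = phi0 (c0 d).
  apply: (gr_eq_lin (phi := fun d => c0 (phi0 d)) (psi := fun d => phi0 (c0 d))) => //.
  - by move=> x y; rewrite linearD c0D.
  - by move=> x y; rewrite c0D linearD.
  move=> t {}d dD.
  by rewrite (c0E _ _ dD) (c0E _ _ (phi0_deg dD)) linearZ.
pose cA := GRing.isZmodMorphism.Build D D c0 (fun x y =>
   (linearB (phi0 \o N) x y : c0 (x - y) = c0 x - c0 y)).
pose cM := GRing.isMonoidMorphism.Build D D c0 (conj c01 c0M).
pose c : {rmorphism D -> D} := HB.pack c0 cA cM.
exists c; split; last first.
  by move=> z; rewrite /c /= (c0E _ _ (cst_gr z)) nu0 scale1r phi0_cst.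
split=> //.
  by move=> a d; rewrite /c /= /c0 !linearZ.
move=> t tT; split; last exact: nu1.
rewrite /c /= (c0E _ _ (X_gr tT)) phi0_X //.
by rewrite scaler_int mulrzl.
Qed.

Section GradedEndomorphism.
Variable psi : D -> D.
Hypothesis psiD : forall x y, psi (x + y) = psi x + psi y.
Hypothesis psiM : forall x y, psi (x * y) = psi x * psi y.
Hypothesis psiZ : forall (a : R) x, psi (a *: x) = a *: psi x.
Hypothesis psi1 : psi 1 = 1.
Hypothesis psi_gr : forall t d, d \in Dg t -> psi d \in Dg t.

(** The image of the imaginary unit is a scalar of square -1, and [psi] is linear over the reals. *)
Lemma psi_cst : (forall z, psi (cst z) = cst z) \/
  (forall z, psi (cst z) = cst (conjc z)).
Proof.
have [w wE] := gr0_cst (psi_gr (cst_gr 'i%C)).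
have psiE a b : psi (cst (a +i* b)%C) = cst (a%:C + b%:C * w)%C.
  have -> : (a +i* b)%C = (a%:C + b%:C * 'i)%C :> R[i] by simpc.
  by rewrite !cstD !cstM !cstR psiD !mulr_algl !psiZ psi1 wE.
have /eqP : w ^+ 2 = 'i%C ^+ 2.
  apply: (proj1 center_C); rewrite -!/(cst _) expr2 cstM -wE -psiM -cstM -expr2 sqr_i.
  by rewrite cstN cst1 -scaleN1r psiZ psi1.
rewrite eqf_sqr => /orP[]/eqP wi; [left | right] => -[a b];
  by rewrite psiE wi; congr cst; simpc.
Qed.

(** Applying [psi] to X_t X_s = b X_s X_t shows that b is real. Having absolute value 1, it
    satisfies b^2 = 1, so the square of X_t is central. It is thus of degree 0 as well as 2t. *)
Lemma conj_elementary2 : (forall z, psi (cst z) = cst (conjc z)) -> elementary2 D.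
Proof.
move=> psiC t tT.
have psiX s : s \in T -> exists2 z, psi (X s) = cst z * X s & z != 0.
  move=> sT; have [z zE] := gr_line sT (psi_gr (X_gr sT)); exists z => //.
  apply/eqP => z0; have : psi (X s / X s) = 0.
    by rewrite psiM zE z0 cst0 !mul0r.
  by rewrite divrr ?X_unit // psi1 => /eqP; rewrite oner_eq0.
have XXG : X t * X t \in Dg (t *+ 2) by rewrite mulr2n gr_mul ?X_gr.
have XX0 : X t * X t != 0 by rewrite (gr_mulf_neq0 (X_gr tT) (X_gr tT)) ?X_neq0.
have ctr x : X t * X t * x = x * (X t * X t).
  apply: (gr_eq_lin (phi := fun x => X t * X t * x) (psi := fun x => x * (X t * X t))).
  - by move=> y z; rewrite mulrDr.
  - by move=> y z; rewrite mulrDl.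
  move=> s {}x xD; have [->|x0] := eqVneq x 0; first by rewrite mulr0 mul0r.
  have sT := gr_mem_supp xD x0.
  have [b [_ b1 bX]] := beta_cst tT sT.
  have [z zE z0] := psiX t tT; have [w wE w0] := psiX s sT.
  have uXs := X_unit sT; have uXt := X_unit tT.
  have bb : conjc b = b.
    have := congr1 psi (bX _ _ (X_gr tT) (X_gr sT)).
    rewrite !psiM psiC zE wE !cst_mulACA // (bX (X t) (X s)) ?X_gr // !mulrA -!cstM.
    move=> /(mulIr uXt)/(mulIr uXs) e.
    have zw0 : z * w != 0 by rewrite mulf_neq0.
    apply: (mulIf zw0); rewrite [w * z]mulrC [z * w * b]mulrC in e.
    by apply: (proj1 center_C); rewrite -!/(cst _) e.
  rewrite -mulrA (bX (X t) x) ?X_gr // mulrA -cst_comm -mulrA.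
  rewrite [X t * (x * _)]mulrA (bX (X t) x) ?X_gr //.
  by rewrite !mulrA -cstM -{1}bb b1 cst1 mul1r.
have [z zE] := center_cst ctr.
by apply: (gr_disjoint XXG _ XX0); rewrite zE cst_gr.
Qed.

End GradedEndomorphism.

(** * Conjugate transposes over D *)

Definition star m n (A : 'M[D]_(m, n)) : 'M[D]_(n, m) := map_mx phi0 A^T.

Lemma starE m n (A : 'M_(m, n)) i j : star A i j = phi0 (A j i).
Proof. by rewrite !mxE. Qed.

Lemma star_mul m n k (A : 'M_(m, n)) (B : 'M_(n, k)) :
  star (A *m B) = star B *m star A.
Proof.
apply/matrixP => i j; rewrite !mxE linear_sum; apply: eq_bigr => l _.
by rewrite /= (proj1 phi0_inv) !mxE.
Qed.

Lemma starK m n (A : 'M_(m, n)) : star (star A) = A.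
Proof. by apply/matrixP => i j; rewrite !mxE (proj2 phi0_inv). Qed.

Lemma star1 n : star 1%:M = 1%:M :> 'M_n.
Proof.
have phi1 : phi0 1 = 1.
  by rewrite -[LHS]mulr1 -{2}[1](proj2 phi0_inv) -(proj1 phi0_inv) mulr1 (proj2 phi0_inv).
by apply/matrixP => i j; rewrite !mxE eq_sym; case: eqP; rewrite ?phi1 ?raddf0.
Qed.

(** * Coordinates on the matrix algebras *)

Variable xi : GT D -> G.
Hypothesis xi_section : forall x, cosetT D (xi x) = x.
Local Notation coset := (cosetT D).

Lemma cosetD g h : coset (g + h) = coset g + coset h.
Proof. exact: Quotient.pi_add. Qed.
Lemma cosetN g : coset (- g) = - coset g.
Proof. exact: Quotient.pi_opp. Qed.
Lemma coset0 : coset 0 = 0.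
Proof. by apply: (addrI (coset 0)); rewrite -cosetD !addr0. Qed.
Lemma coset_eq g h : (coset g == coset h) = (g - h \in T).
Proof. by rewrite Quotient.idealrBE. Qed.
Lemma coset_eq0 g : (coset g == 0) = (g \in T).
Proof. by rewrite -coset0 coset_eq subr0. Qed.

(** Presents (G/T)_{g0} as the fixed points of the map that pairs the blocks, so that fixed and
    exchanged blocks can be treated uniformly. *)
Lemma GTsqP g0 x : GTsq g0 x <-> - coset g0 - x = x.
Proof.
have e g : coset (g0 + g *+ 2) = coset g0 + coset g + coset g.
  by rewrite mulr2n !cosetD addrA.
split=> [[g gT <-]|gx].
  move: gT; rewrite /mkset -coset_eq0 e addr_eq0 => /eqP <-.
  by rewrite addKr.
exists (xi x); last exact: xi_section.
by rewrite /mkset /= -coset_eq0 e xi_section addr_eq0 -[in X in _ == X]gx opprB opprK addrC.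
Qed.

Lemma xi_sum_supp g0 x : g0 + xi x + xi (- coset g0 - x) \in T.
Proof. by rewrite -coset_eq0 !cosetD !xi_section -opprD subrr. Qed.

Section Enumeration.
Variables (p : triple D) (pX : in_X p) (o : enumeration p).
Local Notation I := 'I_(nfix o + (npair o).*2).

(* A row index of M_k(D) is determined by the coset x_i of its block and its
   position in that block, which frees us from the ordering of the blocks. *)
Definition cl (a : 'I_(msize o)) : GT D := ox (tagnat.sig1 a).
Definition pos (a : 'I_(msize o)) : nat := tagnat.sig2 a.

Lemma pos_lt a : (pos a < tkappa p (cl a))%N.
Proof. exact: ltn_ord. Qed.

Lemma cl_pos_inj a b : cl a = cl b -> pos a = pos b -> a = b.
Proof.
move=> /ox_inj e1 e2; apply: val_inj; rewrite /= [LHS]tagnat.rect [RHS]tagnat.rect.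
by rewrite -/(pos a) -/(pos b) e2 e1.
Qed.

Lemma cl_pos_ex x k : (k < tkappa p x)%N -> exists a, cl a = x /\ pos a = k.
Proof.
move=> kx; have /(ox_supp o)[i ix] : tkappa p x <> 0%N by case: (tkappa p x) kx.
have ki : (k < bsize i)%N by rewrite /bsize ix.
exists (tagnat.Rank i (Ordinal ki)); split; first by rewrite /cl tagnat.Rank1K.
by rewrite /pos tagnat.Rank2K.
Qed.

Lemma kappa_opp x : tkappa p (- coset (tg0 p) - x) = tkappa p x.
Proof. by have := pX; case: (p) => g0 k s [[_ _ h] _]; apply: h. Qed.

Lemma mate_nonfixed (i : I) : (nfix o <= i)%N -> exists m : I,
  [/\ m = mate o i :> nat, m != i & ox m = - coset (tg0 p) - ox i].
Proof.
move=> fi; set n := nfix o in fi *; set r := npair o.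
have iE : i = (n + (i - n))%N :> nat by rewrite subnKC.
have := odd_double_half (i - n); set l := (i - n)./2 => lE.
rewrite /mate -/n ltnNge fi /=.
have lt_l : (l < r)%N.
  have := ltn_ord i; rewrite -/n -/r {1}iE ltn_add2l -lE.
  case: odd => /=; last by rewrite add0n ltn_double.
  by rewrite add1n => /ltnW; rewrite ltn_double.
case: ifP lE => /= _ lE.
  have mi : (n + l.*2 < n + r.*2)%N by rewrite ltn_add2l ltn_double.
  exists (Ordinal mi); split.
  - by rewrite /= iE -lE add1n addnS.
  - by rewrite -val_eqE /= iE -lE eqn_add2l add1n ltn_eqF.
  have iE' : i = (n + l.*2).+1 :> nat by rewrite iE -lE add1n addnS.
  by have := @ox_pair _ _ _ _ o (Ordinal mi) i l erefl iE'; move=> <-; rewrite addrK.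
have mi : (n + (l.*2).+1 < n + r.*2)%N.
  by rewrite ltn_add2l -[(_ < _)%N]/((l.*2).+2 <= r.*2)%N -doubleS leq_double.
exists (Ordinal mi); split.
- by rewrite /= iE -lE add0n addnS.
- by rewrite -val_eqE /= iE -lE eqn_add2l add0n gtn_eqF.
have iE' : i = (n + l.*2)%N :> nat by rewrite iE -lE add0n.
have := @ox_pair _ _ _ _ o i (Ordinal mi) l iE'; rewrite -addnS.
by move=> /(_ erefl) <-; rewrite addrC addKr.
Qed.

Lemma fixedE (i : I) : (i < nfix o)%N = `[< GTsq (tg0 p) (ox i) >].
Proof.
apply/idP/asboolP => [/ox_fix//|/GTsqP fx].
rewrite ltnNge; apply/negP => /mate_nonfixed[m [_ /eqP mi]].
by rewrite fx => /ox_inj.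
Qed.

(** The sign of row [a] in S_i; it is 1 on all exchanged blocks. *)
Definition sg (a : 'I_(msize o)) : int :=
  if `[< GTsq (tg0 p) (cl a) >] && ~~ (pos a < npos p (cl a))%N then -1 else 1.

(** One formula for both kinds of blocks: the column block is always the mate of the row block, and
    on a fixed block the index of X is [tau]. *)
Lemma PhiE a b : Phi X xi o a b =
  if (cl b == - coset (tg0 p) - cl a) && (pos a == pos b)
  then (sg a)%:~R * X (tg0 p + xi (cl a) + xi (cl b)) else 0.
Proof.
rewrite mxE /Phi_block mxE /sg -fixedE -/(pos a) -/(pos b).
have -> : (tagnat.sig1 b == mate o (tagnat.sig1 a) :> nat) =
    (cl b == - coset (tg0 p) - cl a).
  have [fa|nfa] := ltnP (tagnat.sig1 a) (nfix o).
    have := fa; rewrite fixedE => /asboolP/GTsqP ->.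
    by rewrite /mate fa /cl (inj_eq (@ox_inj _ _ _ _ o)).
  have [m [<- _ <-]] := mate_nonfixed nfa.
  by rewrite /cl (inj_eq (@ox_inj _ _ _ _ o)).
case: ifP => // /andP[/eqP clb _].
case: ifP => [fa|_]; last by rewrite /= mul1r.
have := fa; rewrite fixedE => /asboolP/GTsqP clE.
rewrite /tau clb /cl clE mulr2n addrA /=.
by case: ifP; rewrite ?mul1r ?mulN1r.
Qed.

End Enumeration.
Lemma mxinv_eq n (A B : 'M[D]_n) : A *m B = 1%:M -> B *m A = 1%:M -> mxinv A = B.
Proof.
move=> AB BA; rewrite /mxinv; case: xgetP => [C _ [AC _]|/(_ B)]; last by case.
by rewrite -[C]mul1mx -BA -mulmxA AC mulmx1.
Qed.

(** * The monomial hermitian matrix [Phi] of a triple *)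

Section OneTriple.
Variables (p : triple D) (pX : in_X p) (o : enumeration p).
Local Notation g0 := (tg0 p).

Lemma mate_involutive x : - coset g0 - (- coset g0 - x) = x.
Proof. by abel. Qed.

(** The positions of the nonzero entries of [Phi]; the next lemmas show that they form the graph of
    an involution of the row indices. *)
Definition partner (a b : 'I_(msize o)) :=
  (cl b == - coset g0 - cl a) && (pos a == pos b).

Lemma partner_sym a b : partner a b = partner b a.
Proof.
rewrite /partner [pos a == _]eq_sym; congr (_ && _).
by apply/eqP/eqP => ->; rewrite mate_involutive.
Qed.

Lemma sg_partner a b : partner a b -> sg a = sg b.
Proof.
move=> /andP[/eqP cb /eqP pab]; rewrite /sg.
case: asboolP => [/GTsqP fa|nfa]; case: asboolP => [/GTsqP fb|nfb] //=.
- by rewrite cb fa pab.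
- by case: nfb; apply/GTsqP; rewrite cb !fa.
by case: nfa; apply/GTsqP; rewrite -cb -fb cb mate_involutive.
Qed.

Lemma partner_ex a : exists b, partner a b.
Proof.
have : (pos a < tkappa p (- coset g0 - cl a))%N by rewrite kappa_opp ?pos_lt.
by move=> /(cl_pos_ex o)[b [cb pb]]; exists b; rewrite /partner cb pb !eqxx.
Qed.

Lemma partner_inj a b c : partner a b -> partner a c -> b = c.
Proof.
move=> /andP[/eqP b1 /eqP b2] /andP[/eqP c1 /eqP c2].
by apply: cl_pos_inj; [rewrite b1 c1 | rewrite -b2 -c2].
Qed.

Lemma partner_supp a b : partner a b -> g0 + xi (cl a) + xi (cl b) \in T.
Proof. by move=> /andP[/eqP -> _]; apply: xi_sum_supp. Qed.

Lemma sgP (a : 'I_(msize o)) : sg a = 1 \/ sg a = -1.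
Proof. by rewrite /sg; case: ifP; [right | left]. Qed.

Lemma sgM (a : 'I_(msize o)) : (sg a)%:~R * (sg a)%:~R = 1 :> D.
Proof. by case: (sgP a) => ->; rewrite ?mulr1 // mulrNN mulr1. Qed.

Lemma phi0_int (n : int) d : phi0 (n%:~R * d) = n%:~R * phi0 d.
Proof. by rewrite !mulrzl raddfMz. Qed.

Lemma Phi_star : star (Phi X xi o) = Phi X xi o.
Proof.
apply/matrixP => a b; rewrite starE !PhiE -/(partner b a) -/(partner a b) partner_sym.
case: ifP => [ab|_]; last by rewrite raddf0.
rewrite phi0_int phi0_X; last by rewrite partner_supp // partner_sym.
by rewrite (sg_partner ab) addrAC.
Qed.

Lemma Phi_inv : exists Psi, Phi X xi o *m Psi = 1%:M /\ Psi *m Phi X xi o = 1%:M.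
Proof.
(* The default [a] never occurs, since every index has a partner. *)
pose mt a := odflt a [pick b | partner a b].
have mtP a : partner a (mt a).
  by rewrite /mt; case: pickP => //= h; case: (partner_ex a) => b; rewrite h.
have mtK : involutive mt.
  by move=> a; apply: partner_inj (mtP _) _; rewrite partner_sym.
pose d b := (sg b)%:~R * X (g0 + xi (cl (mt b)) + xi (cl b)).
have ud b : d b \is a GRing.unit.
  rewrite unitrMl; last by rewrite X_unit // partner_supp // partner_sym.
  by apply/unitrP; exists (sg b)%:~R; rewrite sgM.
have [] := monomial_inv (d := d) (e := fun b => (d b)^-1) mtK mtK.
- by move=> a; apply: mulrV.
- by move=> a; apply: mulVr.
set A := (X in X *m _ = _); set B := (X in _ *m X = _) => AB BA.
exists B; suff -> : Phi X xi o = A by [].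
apply/matrixP => a b; rewrite PhiE -/(partner a b) [RHS]mxE.
have -> : (a == mt b) = partner a b.
  apply/eqP/idP => [->|ab]; first by rewrite partner_sym.
  by apply: partner_inj (mtP _); rewrite partner_sym.
case: ifP => // ab; rewrite /d (sg_partner ab).
suff -> : mt b = a by [].
by apply: (partner_inj (mtP b)); rewrite partner_sym.
Qed.

Lemma index_ex : exists i : 'I_(msize o), True.
Proof.
have [x /eqP] : exists x, tkappa p x <> 0%N by have := pX; case: (p) => ? ? ? [[]].
by rewrite -lt0n => /(cl_pos_ex o)[i _]; exists i.
Qed.

End OneTriple.
Lemma mx_compP (p : triple D) (o : enumeration p) h A :
  mx_comp xi (o:=o) h A <->
  forall a b, A a b \in Dg (h - xi (cl a) + xi (cl b)).
Proof.
split=> [hA a b|hA a b]; last first.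
  exists (h - xi (cl a) + xi (cl b)); last exact: hA.
  by rewrite -/(cl a) -/(cl b); abel.
have [t <- /gr_cast] := hA a b; apply; rewrite -/(cl a) -/(cl b); abel.
Qed.

(** * From isomorphisms to Gram matrices *)

Section IsoFactor.
Variables (p p' : triple D).
Variables (o : enumeration p) (o' : enumeration p').
Variable f : {rmorphism 'M[D]_(msize o) -> 'M[D]_(msize o')}.
Hypothesis f_bij : bijective f.
Hypothesis f_lin : forall (a : R) A, f (a%:A *: A) = a%:A *: f A.
Hypothesis f_gr : forall h A, mx_comp xi (o:=o) h A <-> mx_comp xi (o:=o') h (f A).
Variable i0 : 'I_(msize o).

Let fM A B : f (A *m B) = f A *m f B. Proof. exact: rmorphM. Qed.
Let E d a b : 'M[D]_(msize o) := emx d a b.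

Lemma f_emx_gr t d a b : d \in Dg t -> forall i j,
  f (E d a b) i j \in Dg (t + xi (cl a) - xi (cl b) - xi (cl i) + xi (cl j)).
Proof.
move=> dD i j; apply: (proj1 (mx_compP _ _)).
apply/f_gr/mx_compP => k l; rewrite mxE; case: ifP => [/andP[/eqP-> /eqP->]|_].
  by apply: gr_cast dD _; abel.
exact: mem0v.
Qed.

(** The image e of a diagonal matrix unit is a nonzero idempotent of degree 0. Take a nonzero, hence
    invertible, entry of e, and let v and l be its column and row in e. Then v l lies in the corner
    e M e, which is a copy of D, so it is the image of a homogeneous unit d; dividing v by d gives
    the factorization. *)
Lemma inner_factor : exists (g : G) (v : 'cV[D]_(msize o')) (l : 'rV[D]_(msize o')),
  [/\ v *m l = f (E 1 i0 i0), l *m v = 1%:M,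
      forall i, v i 0 \in Dg (g + xi (cl i0) - xi (cl i)) &
      forall j, l 0 j \in Dg (- g - xi (cl i0) + xi (cl j))].
Proof.
pose e := f (E 1 i0 i0).
have ee : e *m e = e by rewrite /e -fM emxM eqxx mulr1.
have eG i j : e i j \in Dg (- xi (cl i) + xi (cl j)).
  by apply: gr_cast (f_emx_gr i0 i0 (gr_one D) i j) _; abel.
have e0 : e != 0.
  apply/eqP => e0; have : E 1 i0 i0 = 0 by apply: (bij_inj f_bij); rewrite raddf0.
  by move/eqP; rewrite emx_eq0 oner_eq0.
have [a0 [b0 ab0]] : exists a0 b0, e a0 b0 != 0.
  apply: contrapT => h; case/eqP: e0; apply/matrixP => a b; rewrite mxE.
  by apply/eqP; apply/negPn/negP => eab; apply: h; exists a, b.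
have uab : e a0 b0 \is a GRing.unit := gr_unit (eG a0 b0) ab0.
pose v := col b0 e; pose l := row a0 e.
have ev : e *m v = v.
  by apply/matrixP => i j; rewrite [in RHS]/v -[in RHS]ee !mxE; apply: eq_bigr => k _; rewrite mxE.
have le : l *m e = l by rewrite /l -row_mul ee.
have lvE : l *m v = (e a0 b0)%:M.
  apply/matrixP => i j; rewrite !ord1 !mxE eqxx mulr1n -[in RHS]ee mxE.
  by apply: eq_bigr => k _; rewrite !mxE.
have [f' fK f'K] := f_bij.
pose d := f' (v *m l) i0 i0.
have vlE : v *m l = f (E d i0 i0).
  have -> : E d i0 i0 = E 1 i0 i0 *m f' (v *m l) *m E 1 i0 i0.
    by rewrite /E emx_sandwich mul1r mulr1.
  rewrite !fM f'K -/e.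
  by rewrite mulmxA ev -mulmxA le.
have vlG i j : (v *m l) i j \in Dg (xi (cl b0) - xi (cl a0) - xi (cl i) + xi (cl j)).
  rewrite mxE big_ord1 !mxE; apply: gr_cast (gr_mul (eG i b0) (eG a0 j)) _; abel.
have d0 : d != 0.
  apply/eqP => dE; have := vlE; rewrite dE.
  have -> : E 0 i0 i0 = 0 by apply/eqP; rewrite emx_eq0.
  rewrite raddf0 => /matrixP/(_ a0 b0); rewrite mxE big_ord1 !mxE => /eqP.
  by rewrite mulrI_eq0 ?(negPf ab0) //; apply: mulrI.
pose h := xi (cl b0) - xi (cl a0).
have dG : d \in Dg h.
  have /f_gr/mx_compP/(_ i0 i0) : mx_comp xi (o:=o') h (f (E d i0 i0)).
    by apply/mx_compP => i j; rewrite -vlE; apply: vlG.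
  by rewrite mxE !eqxx subrK.
have ud := gr_unit dG d0.
pose w := f (E d^-1 i0 i0) *m v.
have wl : w *m l = e by rewrite /w -mulmxA vlE -fM emxM eqxx mulVr.
(* From l w l = l, after cancelling the invertible entry l v. *)
have lw : l *m w = 1%:M.
  have lwl : l *m w *m l = l by rewrite -mulmxA wl le.
  have : l *m w *m (l *m v) = l *m v by rewrite mulmxA lwl.
  rewrite lvE => /matrixP/(_ 0 0); rewrite !mxE big_ord1 !mxE eqxx mulr1n.
  rewrite -[RHS]mul1r => /(mulIr uab) e1.
  by apply/matrixP => i j; rewrite !ord1 mxE e1 !mxE.
exists (xi (cl a0) - xi (cl i0)), w, l; split=> //.
- move=> i; rewrite mxE; apply: rpred_sum => k _; rewrite mxE.
  apply: gr_cast (gr_mul (f_emx_gr i0 i0 (gr_inv dG d0) i k) (eG k b0)) _.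
  by rewrite /h; abel.
- by move=> j; rewrite mxE; apply: gr_cast (eG a0 j) _; abel.
Qed.


(** [psi] is the action of [f] on the corner D of the matrix unit at [i0], read through l and v. The
    rows of Q are the l f(E_{i0 b}) and the columns of P the f(E_{b i0}) v, so that P Q is the sum
    of the f(E_{bb}), which is 1. *)
Lemma graded_iso_factor : exists (g : G) (psi : D -> D)
    (Q : 'M[D]_(msize o, msize o')) (P : 'M[D]_(msize o', msize o)),
  [/\ [/\ P *m Q = 1%:M, Q *m P = 1%:M & forall A, Q *m f A *m P = map_mx psi A],
      (forall b a, Q b a \in Dg (- xi (cl b) - g + xi (cl a))) /\
      (forall a b, P a b \in Dg (- xi (cl a) + g + xi (cl b))),
      (forall x y, psi (x + y) = psi x + psi y) /\
      (forall x y, psi (x * y) = psi x * psi y),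
      (forall (a : R) x, psi (a *: x) = a *: psi x) /\ psi 1 = 1 &
      forall t d, d \in Dg t -> psi d \in Dg t].
Proof.
have [g [v [l [vl lv vG lG]]]] := inner_factor.
pose psi d := (l *m f (E d i0 i0) *m v) 0 0.
pose Q := \matrix_(b, a) (l *m f (E 1 i0 b)) 0 a.
pose P := \matrix_(a, b) (f (E 1 b i0) *m v) a 0.
have prodE A B : l *m f (A *m E 1 i0 i0 *m B) *m v =
    (l *m f A *m v) *m (l *m f B *m v).
  by rewrite !fM -vl !mulmxA.
have prod00 A B : (l *m f (A *m E 1 i0 i0 *m B) *m v) 0 0 =
    (l *m f A *m v) 0 0 * (l *m f B *m v) 0 0.
  by rewrite prodE mxE big_ord1.
have QE b a : Q b a = (l *m f (E 1 i0 b)) 0 a by rewrite mxE.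
have PE a b : P a b = (f (E 1 b i0) *m v) a 0 by rewrite mxE.
have row_of (A : 'M_(msize o')) b j : (Q *m A) b j = (l *m f (E 1 i0 b) *m A) 0 j.
  by rewrite !mxE; apply: eq_bigr => k _; rewrite QE.
exists g, psi, Q, P; split; [split|split|split|split|].
- apply/matrixP => i j; transitivity ((\sum_b f (E 1 b b)) i j); last first.
    by rewrite -raddf_sum /= sum_emx rmorph1.
  rewrite mxE summxE; apply: eq_bigr => b _.
  have -> : E 1 b b = E 1 b i0 *m E 1 i0 i0 *m E 1 i0 b.
    by rewrite /E !(emxM, eqxx, mulr1).
  by rewrite !fM -vl PE QE mulmxA -mulmxA [RHS]mxE big_ord1.
- apply/matrixP => b c; transitivity ((l *m f (E 1 i0 b) *m (f (E 1 c i0) *m v)) 0 0).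
    by rewrite !mxE; apply: eq_bigr => a _; rewrite QE PE.
  rewrite mulmxA -[l *m _ *m _]mulmxA -fM /E emxM mulr1 [RHS]mxE.
  case: eqP => _; last by rewrite raddf0 mulmx0 mul0mx mxE.
  by rewrite -vl !mulmxA lv mul1mx lv mxE eqxx.
- move=> A; apply/matrixP => b c.
  transitivity ((l *m f (E 1 i0 b) *m f A *m (f (E 1 c i0) *m v)) 0 0).
    by rewrite !mxE; apply: eq_bigr => a _; rewrite row_of PE.
  rewrite [RHS]mxE /psi; congr (fun_of_matrix _ 0 0).
  have -> : E (A b c) i0 i0 = E 1 i0 b *m A *m E 1 c i0.
    by rewrite /E emx_sandwich mul1r mulr1.
  by rewrite !fM !mulmxA.
- move=> b a; rewrite QE mxE; apply: rpred_sum => k _.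
  by apply: gr_cast (gr_mul (lG k) (f_emx_gr i0 b (gr_one D) k a)) _; abel.
- move=> a b; rewrite PE mxE; apply: rpred_sum => k _.
  by apply: gr_cast (gr_mul (f_emx_gr b i0 (gr_one D) a k) (vG k)) _; abel.
- by move=> x y; rewrite /psi /E emxD raddfD mulmxDr mulmxDl mxE.
- move=> x y; rewrite /psi -prod00; congr ((l *m f _ *m v) 0 0).
  by rewrite /E !(emxM, eqxx, mulr1).
- move=> a x; rewrite /psi -mulr_algl /E scale_emx f_lin.
  have -> : l *m (a%:A *: f (E x i0 i0)) = a%:A *: (l *m f (E x i0 i0)).
    apply/matrixP => i j; rewrite !mxE mulr_sumr; apply: eq_bigr => k _.
    by rewrite !mxE !mulr_algl scalerAr.
  by rewrite -scalemxAl mxE mulr_algl.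
- by rewrite /psi -vl !mulmxA lv mul1mx lv mxE.
move=> t d dD; rewrite /psi mxE; apply: rpred_sum => k _; rewrite mxE mulr_suml.
apply: rpred_sum => m _.
apply: gr_cast (gr_mul (gr_mul (lG m) (f_emx_gr i0 i0 dD m k)) (vG k)) _.
by abel.
Qed.
End IsoFactor.
Lemma mul_mx_cst m n k (A : 'M[D]_(m, n)) (B : 'M_(n, k)) z :
  A *m (cst z *: B) = cst z *: (A *m B).
Proof.
apply/matrixP => i j; rewrite !mxE mulr_sumr; apply: eq_bigr => l _.
by rewrite !mxE !mulrA cst_comm.
Qed.

Lemma mul_mx_real m n k (A : 'M[D]_(m, n)) (B : 'M_(n, k)) (r : R) :
  A *m (r%:A *: B) = r%:A *: (A *m B).
Proof. by rewrite -cstR mul_mx_cst. Qed.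

Section Gram.
Variables (p p' : triple D) (pX : in_X p) (p'X : in_X p').
Variables (o : enumeration p) (o' : enumeration p').
Local Notation F := (Phi X xi o).
Local Notation F' := (Phi X xi o').

(** Congruence of the forms c(Phi) and r Phi' under a homogeneous change of basis of degree shift
    g. *)
Definition gram_rel (c : D -> D) : Prop :=
  exists (g : G) (Q : 'M[D]_(msize o, msize o')) (P : 'M[D]_(msize o', msize o)) (r : R),
  [/\ P *m Q = 1%:M, Q *m P = 1%:M,
      (forall b a, Q b a \in Dg (- xi (cl b) - g + xi (cl a))) /\
      (forall a b, P a b \in Dg (- xi (cl a) + g + xi (cl b))),
      r != 0 &
      star Q *m map_mx c F *m Q = r%:A *: F'].

Section Twisted.
Variables (mu : G -> int) (c : {rmorphism D -> D}).
Hypothesis c_twist : sign_twist mu c.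

Let c_gr t d : d \in Dg t -> c d \in Dg t. Proof. by case: c_twist => h *; apply: h. Qed.
Let cK d : c (c d) = d. Proof. by case: c_twist. Qed.
Let c_phi d : c (phi0 d) = phi0 (c d). Proof. by case: c_twist. Qed.
Let cZ (a : R) d : c (a *: d) = a *: c d. Proof. by case: c_twist. Qed.

Lemma map_star m n (A : 'M_(m, n)) : map_mx c (star A) = star (map_mx c A).
Proof. by apply/matrixP => i j; rewrite mxE !starE mxE c_phi. Qed.

Lemma map_twistK m n (A : 'M_(m, n)) : map_mx c (map_mx c A) = A.
Proof. by apply/matrixP => i j; rewrite !mxE cK. Qed.

(** The isomorphism is A |-> P c(A) Q. The factor r is central, so r Phi' and Phi' define the same
    involution. *)
Lemma gram_M_iso : gram_rel c -> M_iso phi0 X xi o o'.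
Proof.
move=> [g [Q [P [r [PQ QP [QG PG] r0 QFQ]]]]].
have [S [FS SF]] := Phi_inv pX o.
have [S' [FS' SF']] :=
  Phi_inv p'X o'.
pose f0 (A : 'M[D]_(msize o)) := P *m map_mx c A *m Q.
have f0B A B : f0 (A - B) = f0 A - f0 B by rewrite /f0 map_mxB mulmxBr mulmxBl.
have f0M : monoid_morphism f0.
  split; first by rewrite /f0 rmorph1 mulmx1.
  move=> A B; rewrite /f0 -!mulmxE map_mxM !mulmxA; congr (_ *m _ *m _).
  by rewrite -[RHS]mulmxA QP mulmx1.
pose fA := GRing.isZmodMorphism.Build _ _ f0 f0B.
pose fM := GRing.isMonoidMorphism.Build _ _ f0 f0M.
pose f : {rmorphism 'M[D]_(msize o) -> 'M[D]_(msize o')} := HB.pack f0 fA fM.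
have Qf A : Q *m f A *m P = map_mx c A.
  by rewrite /f /= /f0 !mulmxA QP mul1mx -mulmxA QP mulmx1.
exists f; split.
- exists (fun B => map_mx c (Q *m B *m P)) => [A|B]; first by rewrite Qf map_twistK.
  by rewrite /f /= /f0 map_twistK !mulmxA PQ mul1mx -mulmxA PQ mulmx1.
- move=> a A; rewrite /f /= /f0 map_mxZ /= cZ rmorph1.
  by rewrite mul_mx_real -scalemxAl.
- move=> h A; split=> [/mx_compP AG|/mx_compP AG]; apply/mx_compP => a b.
    rewrite mxE; apply: rpred_sum => k _; rewrite mxE mulr_suml; apply: rpred_sum => l _.
    rewrite mxE; apply: gr_cast (gr_mul (gr_mul (PG a l) (c_gr (AG l k))) (QG k b)) _.
    by abel.
  have -> : A a b = c ((Q *m f A *m P) a b) by rewrite Qf mxE cK.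
  apply: c_gr.
  rewrite mxE; apply: rpred_sum => k _; rewrite mxE mulr_suml; apply: rpred_sum => l _.
  by apply: gr_cast (gr_mul (gr_mul (QG a l) (AG l k)) (PG k b)) _; abel.
move=> A; rewrite /mx_inv (mxinv_eq FS SF) (mxinv_eq FS' SF') -!/(star _).
rewrite /f /= /f0 !map_mxM map_star !star_mul.
have E1 : map_mx c F *m Q = r%:A *: (star P *m F').
  by rewrite -mul_mx_real -QFQ !mulmxA -star_mul QP star1 mul1mx.
have E2 : S' *m star Q = r%:A *: (P *m map_mx c S).
  have KS : map_mx c F *m map_mx c S = 1%:M by rewrite -map_mxM FS map_mx1.
  rewrite -[LHS]mulmx1 -KS -[map_mx c F]mulmx1 -QP !mulmxA.
  rewrite -(mulmxA S') -(mulmxA S') QFQ mul_mx_real SF'.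
  by rewrite -!scalemxAl mul1mx.
rewrite !mulmxA E2 -!mulmxA E1 !mul_mx_real -!scalemxAl.
by rewrite !mulmxA.
Qed.

(** With W = P^* Phi' P and K = c(Phi), compatibility with the involutions says that W K^{-1}
    commutes with all matrices. Hence W = z K with z in C, and z is real because both sides of the
    Gram identity are hermitian. *)
Lemma iso_gram_rel (f : {rmorphism 'M[D]_(msize o) -> 'M[D]_(msize o')})
    (g : G) (Q : 'M[D]_(msize o, msize o')) (P : 'M[D]_(msize o', msize o)) :
  (forall A, f (mx_inv phi0 X xi A) = mx_inv phi0 X xi (f A)) ->
  P *m Q = 1%:M -> Q *m P = 1%:M ->
  (forall A, Q *m f A *m P = map_mx c A) ->
  (forall b a, Q b a \in Dg (- xi (cl b) - g + xi (cl a))) ->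
  (forall a b, P a b \in Dg (- xi (cl a) + g + xi (cl b))) ->
  gram_rel c.
Proof.
move=> f_inv PQ QP Qf QG PG.
have [S [FS SF]] := Phi_inv pX o.
have [S' [FS' SF']] :=
  Phi_inv p'X o'.
have fE A : f A = P *m map_mx c A *m Q.
  by rewrite -Qf !mulmxA PQ mul1mx -mulmxA PQ mulmx1.
set K := map_mx c F; set K' := map_mx c S.
have KK' : K *m K' = 1%:M by rewrite -map_mxM FS map_mx1.
have K'K : K' *m K = 1%:M by rewrite -map_mxM SF map_mx1.
have invE A : mx_inv phi0 X xi A = S *m star A *m F.
  by rewrite /mx_inv (mxinv_eq FS SF).
have invE' A : mx_inv phi0 X xi A = S' *m star A *m F'.
  by rewrite /mx_inv (mxinv_eq FS' SF').
pose W := star P *m F' *m P.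
have comm B : W *m K' *m B = B *m (W *m K').
  have := f_inv (star (map_mx c B)).
  rewrite invE invE' starK !fE !map_mxM map_twistK -/K -/K'.
  rewrite map_star map_twistK !star_mul starK => e.
  have QPs : star P *m star Q = 1%:M by rewrite -star_mul QP star1.
  have WB : W *m K' *m B *m K = B *m W.
    have /(congr1 (fun A => star P *m F' *m A *m P)) := e.
    rewrite /W !mulmxA -[_ *m Q *m P]mulmxA QP mulmx1 => ->.
    by rewrite -[star P *m F' *m S']mulmxA FS' mulmx1 QPs mul1mx.
  by rewrite mulmxA -WB -!mulmxA KK' mulmx1.
have [i0 _] := index_ex pX o.
have [ZE Zc] := central_mx i0 comm.
have [z zE] := center_cst Zc.
rewrite zE in ZE.
have WE : W = cst z *: K.
  by rewrite -[W]mulmx1 -K'K mulmxA ZE mul_scalar_mx.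
have F'E : F' = cst z *: (star Q *m K *m Q).
  have -> : F' = star Q *m W *m Q.
    by rewrite /W !mulmxA -star_mul PQ star1 mul1mx -mulmxA PQ mulmx1.
  by rewrite WE mul_mx_cst -scalemxAl.
have [j0 _] := index_ex p'X o'.
have cst_inj u w : cst u *: F' = cst w *: F' -> u = w.
  move=> /(congr1 (fun A => (A *m S') j0 j0)); rewrite -!scalemxAl FS' !mxE eqxx !mulr1.
  exact: (proj1 center_C).
have z0 : z != 0.
  apply/eqP => z0; have : cst 1 *: F' = cst 0 *: F'.
    by rewrite cst0 scale0r F'E z0 cst0 scale0r scaler0.
  by move=> /cst_inj/eqP; rewrite oner_eq0.
have QKQ : star Q *m K *m Q = cst z^-1 *: F'.
  by rewrite F'E scalerA -cstM mulVf // cst1 scale1r.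
have wr : conjc z^-1 = z^-1.
  apply: cst_inj; have := congr1 (@star _ _) QKQ.
  have -> : star (cst z^-1 *: F') = cst (conjc z^-1) *: F'.
    apply/matrixP => i j; rewrite starE mxE phi0M phi0_cst -cst_comm [RHS]mxE.
    by rewrite -[in RHS](Phi_star o') starE.
  by rewrite !star_mul starK -map_star (Phi_star o) mulmxA QKQ => ->.
exists g, Q, P, (complex.Re z^-1); split=> //.
  apply: contraNneq z0 => z0; rewrite -invr_eq0 -(cst_eq0).
  by rewrite (real_cst wr) z0 scale0r.
by rewrite -(real_cst wr) -QKQ.
Qed.
End Twisted.

(** Since psi c fixes C, it is conjugation by some homogeneous y. Replacing Q by y^{-1} Q and P by P
    y turns psi into c. *)
Lemma twisted_factor_gram (mu : G -> int) (c : {rmorphism D -> D})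
    (f : {rmorphism 'M[D]_(msize o) -> 'M[D]_(msize o')})
    (g : G) (Q : 'M[D]_(msize o, msize o')) (P : 'M[D]_(msize o', msize o)) psi :
  sign_twist mu c ->
  (forall A, f (mx_inv phi0 X xi A) = mx_inv phi0 X xi (f A)) ->
  P *m Q = 1%:M -> Q *m P = 1%:M ->
  (forall A, Q *m f A *m P = map_mx psi A) ->
  (forall b a, Q b a \in Dg (- xi (cl b) - g + xi (cl a))) ->
  (forall a b, P a b \in Dg (- xi (cl a) + g + xi (cl b))) ->
  (forall x y, psi (x + y) = psi x + psi y) ->
  (forall x y, psi (x * y) = psi x * psi y) ->
  (forall t d, d \in Dg t -> psi d \in Dg t) ->
  (forall z, psi (c (cst z)) = cst z) ->
  gram_rel c.
Proof.
move=> c_twist f_inv PQ QP Qf QG PG psiD psiM psi_gr psic.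
have [c_gr cK _ _ _] := c_twist.
have [] := skolem_noether (th := psi \o c).
- by move=> x y /=; rewrite rmorphD psiD.
- by move=> x y /=; rewrite rmorphM psiM.
- by move=> t d dD; apply/psi_gr/c_gr.
- exact: psic.
move=> u [y [yD y0 psiy]].
have uy := gr_unit yD y0.
have ycy d : y^-1 * psi d * y = c d.
  by have /= := psiy (c d); rewrite cK -mulrA => ->; rewrite mulKr.
pose Q1 := y^-1 *: Q; pose P1 : 'M_(_, _) := \matrix_(a, b) (P a b * y).
have mulP1 m (A : 'M_(m, _)) i j : (A *m P1) i j = (A *m P) i j * y.
  by rewrite !mxE mulr_suml; apply: eq_bigr => k _; rewrite mxE mulrA.
apply: (iso_gram_rel c_twist f_inv (g := g + u) (Q := Q1) (P := P1)).
- rewrite -PQ; apply/matrixP => i j; rewrite !mxE; apply: eq_bigr => k _.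
  by rewrite !mxE -mulrA mulVKr.
- rewrite -scalemxAl; apply/matrixP => i j; rewrite mxE mulP1 QP !mxE.
  by case: eqP; rewrite ?mul0r ?mulr0 // mul1r mulVr.
- move=> A; rewrite -!scalemxAl; apply/matrixP => i j.
  by rewrite mxE mulP1 Qf !mxE mulrA ycy.
- by move=> b a; rewrite mxE; apply: gr_cast (gr_mul (gr_inv yD y0) (QG b a)) _; abel.
- by move=> a b; rewrite mxE; apply: gr_cast (gr_mul (PG a b) yD) _; abel.
Qed.

Lemma M_iso_gram : M_iso phi0 X xi o o' -> gram_rel idfun \/
  (elementary2 D /\ forall (nu : G -> int) (c : {rmorphism D -> D}),
    sign_twist nu c -> (forall z, c (cst z) = cst (conjc z)) -> gram_rel c).
Proof.
move=> [f [f_bij f_lin f_gr f_inv]]; have [i0 _] := index_ex pX o.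
have [g [psi [Q [P [[PQ QP Qf] [QG PG] [psiD psiM] [psiZ psi1] psi_gr]]]]] :=
  graded_iso_factor f_bij f_lin f_gr i0.
have [psi_id|psi_conj] := psi_cst psiD psiM psiZ psi1 psi_gr.
  left; apply: (twisted_factor_gram (c := idfun) sign_twist_id
    f_inv PQ QP Qf QG PG) => //.
right; split.
  exact: (conj_elementary2 psiM psi1 psi_gr).
move=> nu c c_twist c_conj.
apply: (twisted_factor_gram c_twist f_inv PQ QP Qf QG PG) => // z.
by rewrite c_conj psi_conj conjcK.
Qed.

End Gram.

(** * Invariants of Gram matrices *)

Section Counting.
Variables (p : triple D) (pX : in_X p) (o : enumeration p).

Definition cnt (x : GT D) (e : int) : nat :=
  #|[set a : 'I_(msize o) | (cl a == x) && (sg a == e)]|.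

Lemma card_cl_pos x m : (m <= tkappa p x)%N ->
  #|[set a : 'I_(msize o) | (cl a == x) && (pos a < m)%N]| = m.
Proof.
move=> mk; have ex (k : 'I_m) : exists a : 'I_(msize o), cl a = x /\ pos a = k.
  by apply: cl_pos_ex; apply: leq_trans (ltn_ord k) mk.
have [h hP] := choice ex.
have h_inj : injective h.
  by move=> j k jk; apply: val_inj; rewrite /= -(proj2 (hP j)) -(proj2 (hP k)) jk.
rewrite -[RHS]card_ord -cardsT -(card_imset _ h_inj); apply: eq_card => a.
rewrite !inE; apply/andP/imsetP => [[/eqP ca pa]|[k _ ->]].
  exists (Ordinal pa) => //; have [c1 c2] := hP (Ordinal pa).
  by apply: cl_pos_inj; rewrite ?c1 ?c2.
by have [-> ->] := hP k; rewrite eqxx ltn_ord.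
Qed.

Lemma card_cl x : #|[set a : 'I_(msize o) | cl a == x]| = tkappa p x.
Proof.
rewrite -[RHS](card_cl_pos (leqnn _)); apply: eq_card => a; rewrite !inE.
by case: eqP => [<-|//]; rewrite pos_lt.
Qed.

Lemma cnt_add x : (cnt x 1 + cnt x (-1) = tkappa p x)%N.
Proof.
rewrite -card_cl -[RHS](cardsID [set a | sg a == 1]); congr (_ + _)%N; apply: eq_card => a.
  by rewrite !inE.
by rewrite !inE andbC; congr (_ && _); case: (sgP a) => ->.
Qed.

Lemma sigma_eq0 x : ~ GTsq (tg0 p) x -> tsigma p x = 0.
Proof. by have := pX; case: (p) => g0 k s [_ [_ h _]]; apply: h. Qed.

(** The parity condition makes the halving exact, and |sigma| <= kappa makes the absolute value
    harmless. *)
Lemma npos_spec x : GTsq (tg0 p) x -> (npos p x <= tkappa p x)%N /\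
  ((npos p x).*2)%:Z = (tkappa p x)%:Z + tsigma p x.
Proof.
have := pX; case: (p) => g0 k s [_ [/= h1 _ h3]] /h3 sk.
have ks : `|s x| <= (k x)%:Z := h1 x.
rewrite /npos /=; set n := ((k x)%:Z + s x)%R.
move: ks sk; rewrite /n; move: (s x) (k x) => sx kx; lia.
Qed.

Lemma cnt_npos x : GTsq (tg0 p) x -> cnt x 1 = npos p x.
Proof.
move=> xsq; rewrite -[RHS](card_cl_pos (proj1 (npos_spec xsq))).
apply: eq_card => a; rewrite !inE; case: eqP => [ca|//] /=.
by rewrite /sg ca; case: asboolP => // _; case: ltnP.
Qed.

Lemma sigma_cnt x : GTsq (tg0 p) x -> tsigma p x = (cnt x 1)%:Z - (cnt x (-1))%:Z.
Proof.
move=> xsq; have [_] := npos_spec xsq; rewrite -cnt_npos // -cnt_add.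
move: (cnt x 1) (cnt x (-1)) (tsigma p x) => m n s; lia.
Qed.

End Counting.

Lemma shift_supp g x y : y = x - coset g -> - xi y - g + xi x \in T.
Proof.
move=> ->; rewrite -(coset_eq0) !cosetD !cosetN !xi_section; apply/eqP; abel.
Qed.

Lemma shift_supp_neq g x y : y <> x - coset g -> - xi y - g + xi x \notin T.
Proof.
move=> yx; rewrite -(coset_eq0) !cosetD !cosetN !xi_section.
apply/eqP => e; apply: yx; rewrite -[RHS]subr0 -e; abel.
Qed.

(** * Blocks of a homogeneous matrix *)

Section Coefficients.
Variables (p1 p2 : triple D) (o1 : enumeration p1) (o2 : enumeration p2) (g : G).
Variable M : 'M[D]_(msize o1, msize o2).
Hypothesis MG : forall b a, M b a \in Dg (- xi (cl b) - g + xi (cl a)).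

Lemma shift_eq0 b a : cl b <> cl a - coset g -> M b a = 0.
Proof.
move=> ba; apply/eqP; apply: contraT => M0.
by have := shift_supp_neq ba; rewrite (gr_mem_supp (MG b a) M0).
Qed.

(** Within a block every entry lies on the complex line of the same X_u, which reduces the block to
    a complex matrix. *)
Lemma shift_coef : exists q : 'I_(msize o1) -> 'I_(msize o2) -> R[i],
  forall b a, cl b = cl a - coset g ->
    M b a = cst (q b a) * X (- xi (cl b) - g + xi (cl a)).
Proof.
suff ex b : exists q : 'I_(msize o2) -> R[i], forall a, cl b = cl a - coset g ->
    M b a = cst (q a) * X (- xi (cl b) - g + xi (cl a)).
  by have [q qE] := choice ex; exists q => b a; apply: qE.
suff ex a : exists q, cl b = cl a - coset g ->
    M b a = cst q * X (- xi (cl b) - g + xi (cl a)).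
  by have [q qE] := choice ex; exists q => a; apply: qE.
have [ba|ba] := pselect (cl b = cl a - coset g); last by exists 0.
by have [z zE] := gr_line (shift_supp ba) (MG b a); exists z.
Qed.

(** The columns of block x vanish outside the rows of block x - g. If there were more columns than
    rows, [M] would kill a nonzero vector, although it has a left inverse. *)
Lemma kappa_le (N : 'M[D]_(msize o2, msize o1)) x : N *m M = 1%:M ->
  (tkappa p2 x <= tkappa p1 (x - coset g)%R)%N.
Proof.
move=> NM; have [q qE] := shift_coef.
rewrite leqNgt -(card_cl o1) -(card_cl o2); apply/negP.
move=> /(underdetermined q)[v [[a0 va0] vB vA]].
pose V : 'cV[D]_(msize o2) := \col_a cst (v a).
have : V = 0.
  rewrite -[V]mul1mx -NM -mulmxA; suff -> : M *m V = 0 by rewrite mulmx0.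
  apply/colP => b; rewrite !mxE.
  have [cb|ncb] := eqVneq (cl b) (x - coset g); last first.
    apply: big1 => a _; rewrite mxE.
    have [ca|nca] := eqVneq (cl a) x; last by rewrite vB ?inE // cst0 mulr0.
    by rewrite shift_eq0 ?mul0r // ca; apply/eqP.
  have := vA b; rewrite inE cb eqxx => /(_ isT).
  move=> /(congr1 (fun z => cst z * X (- xi (cl b) - g + xi x))).
  rewrite cst0 mul0r cst_sum mulr_suml => e; rewrite -[RHS]e; apply: eq_bigr => a _.
  rewrite mxE; have [ca|nca] := eqVneq (cl a) x; last first.
    by rewrite vB ?inE // mulr0 cst0 mulr0 mul0r.
  by rewrite qE ?cb ?ca // -mulrA -cst_comm mulrA -cstM.
move=> /colP/(_ a0); rewrite !mxE => /eqP; rewrite (cst_eq0).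
by rewrite (negPf va0).
Qed.

End Coefficients.

(** * Hermitian forms on the fixed blocks and their signatures *)

Lemma sgz_pm1 (a : R) : a != 0 -> sgz a = 1 \/ sgz a = -1.
Proof. by case: ltrgt0P => // a0 _; [left; apply: gtr0_sgz | right; apply: ltr0_sgz]. Qed.

Definition nsq (z : R[i]) : R := complex.Re z ^+ 2 + complex.Im z ^+ 2.

Lemma nsqE z : conjc z * z = (nsq z)%:C%C.
Proof.
case: z => a b; rewrite /nsq /=; simpc.
by apply/eqP; rewrite eq_complex /= !expr2 [b * a]mulrC addrN !eqxx.
Qed.

Lemma nsq_ge0 z : 0 <= nsq z.
Proof. by rewrite addr_ge0 ?sqr_ge0. Qed.

Lemma nsq_eq0 z : (nsq z == 0) = (z == 0).
Proof.
by rewrite paddr_eq0 ?sqr_ge0 // !sqrf_eq0 eq_complex.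
Qed.

(** On a fixed block [Phi] is diagonal, and the central coefficients w come out in front as
    |w|^2. *)
Lemma herm_value (mu : G -> int) (c : {rmorphism D -> D}) (p : triple D)
    (o : enumeration p) (x : GT D) (w : 'I_(msize o) -> R[i]) (Y : D)
    (W : 'cV[D]_(msize o)) :
  sign_twist mu c -> GTsq (tg0 p) x -> phi0 Y = Y ->
  (forall a, cl a = x -> W a 0 = cst (w a) * Y) ->
  (forall a, cl a <> x -> W a 0 = 0) ->
  (star W *m map_mx c (Phi X xi o) *m W) 0 0 =
  (\sum_(a | cl a == x) nsq (w a) * (sg a)%:~R) *:
    (Y * c (X (tau xi (tg0 p) x)) * Y).
Proof.
move=> [_ _ _ cZ _] /GTsqP xsq YY WE W0.
transitivity (\sum_(a | cl a == x)
    phi0 (W a 0) * c (Phi X xi o a a) * W a 0).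
  rewrite mxE (bigID (fun a => cl a == x)) /= [X in _ + X]big1 ?addr0; last first.
    by move=> a /eqP ax; rewrite W0 // mulr0.
  apply: eq_bigr => a /eqP ax; congr (_ * _).
  rewrite mxE (bigD1 a) //= starE mxE big1 ?addr0 // => b ba.
  rewrite starE mxE; have [bx|/eqP bx] := eqVneq (cl b) x; last first.
    by rewrite W0 // linear0 mul0r.
  rewrite PhiE; case: ifP => [/andP[_ /eqP pba]|_]; last by rewrite rmorph0 mulr0.
  by case/eqP: ba; apply: cl_pos_inj; rewrite ?bx ?ax.
rewrite scaler_suml; apply: eq_bigr => a /eqP ax; rewrite WE // PhiE ax xsq !eqxx /=.
rewrite phi0M phi0_cst YY -addrA -mulr2n -/(tau xi (tg0 p) x).
rewrite rmorphM rmorph_int.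
rewrite -[(w a)]/(w a) mulrA -[Y * cst _]cst_comm.
have -> : cst (conjc (w a)) * Y * ((sg a)%:~R * c (X (tau xi (tg0 p) x))) * cst (w a) * Y =
   (cst (conjc (w a)) * cst (w a)) * ((sg a)%:~R * (Y * c (X (tau xi (tg0 p) x)) * Y)).
  rewrite -[_ * cst (w a)]cst_comm !mulrA -!cstM [w a * _]mulrC -!mulrA.
  by congr (_ * _); rewrite !mulrA; congr (_ * _ * _); rewrite (commr_int Y).
rewrite -cstM nsqE cstR -scalerA !mulr_algl; congr (_ *: _).
by rewrite scaler_int mulrzl.
Qed.


Section FromGram.
Variables (mu : G -> int) (c : {rmorphism D -> D}).
Hypothesis c_twist : sign_twist mu c.
Variables (p p' : triple D) (pX : in_X p) (p'X : in_X p').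
Variables (o : enumeration p) (o' : enumeration p').
Local Notation F := (Phi X xi o).
Local Notation F' := (Phi X xi o').
Variables (g : G) (Q : 'M[D]_(msize o, msize o')) (P : 'M[D]_(msize o', msize o)).
Variable r : R.
Hypothesis PQ : P *m Q = 1%:M.
Hypothesis QP : Q *m P = 1%:M.
Hypothesis QG : forall b a, Q b a \in Dg (- xi (cl b) - g + xi (cl a)).
Hypothesis PG : forall a b, P a b \in Dg (- xi (cl a) + g + xi (cl b)).
Hypothesis r0 : r != 0.
Hypothesis QFQ : star Q *m map_mx c F *m Q = r%:A *: F'.

(** The two sides of the Gram identity are compared in degree, at a nonzero entry of Phi'. *)
Lemma gram_degree : tg0 p' = tg0 p - g *+ 2.
Proof.
have [i _] := index_ex p'X o'.
have [j ij] := partner_ex p'X i.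
have tT := partner_supp ij.
have FX : F' i j = (sg i)%:~R * X (tg0 p' + xi (cl i) + xi (cl j)).
  by rewrite PhiE -/(partner i j) ij.
have F0 : F' i j != 0.
  rewrite FX; case: (sgP i) => ->; rewrite ?mul1r ?X_neq0 //.
  by rewrite mulN1r oppr_eq0 X_neq0.
have FG : F' i j \in Dg (tg0 p' + xi (cl i) + xi (cl j)).
  by rewrite FX mulrzl rpredMz // X_gr.
have := congr1 (fun A : 'M[D]_(msize o') => A i j) QFQ; rewrite [RHS]mxE mulr_algl => e.
have rF0 : r *: F' i j != 0 by rewrite scaler_eq0 negb_or r0.
have rFG : r *: F' i j \in Dg (tg0 p' + xi (cl i) + xi (cl j)) by rewrite rpredZ.
have [c_gr _ _ _ _] := c_twist.
have : r *: F' i j \in Dg (tg0 p - g *+ 2 + xi (cl i) + xi (cl j)).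
  rewrite -e mxE; apply: rpred_sum => b' _; rewrite mxE mulr_suml.
  apply: rpred_sum => b _; rewrite starE mxE.
  have := PhiE b b'; case: ifP => [bb|_] ->; last first.
    by rewrite rmorph0 mulr0 mul0r mem0v.
  have ttT := partner_supp bb.
  have cG : c ((sg b)%:~R * X (tg0 p + xi (cl b) + xi (cl b'))) \in
      Dg (tg0 p + xi (cl b) + xi (cl b')).
    by apply: c_gr; rewrite mulrzl rpredMz // X_gr.
  apply: gr_cast (gr_mul (gr_mul (phi0_deg (QG b i)) cG) (QG b' j)) _.
  by abel.
move=> /(gr_disjoint rFG)/(_ rF0)/addIr/addIr.
exact.
Qed.

(** Both inequalities are [kappa_le], for Q with shift g and for its inverse P with shift - g. *)
Lemma gram_kappa x : tkappa p' x = tkappa p (x - coset g).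
Proof.
apply/eqP; rewrite eqn_leq (kappa_le QG x PQ) /=.
have PG' a b : P a b \in Dg (- xi (cl a) - - g + xi (cl b)) by rewrite opprK.
have := kappa_le PG' (x - coset g) QP.
by rewrite cosetN opprK subrK.
Qed.

Lemma gram_GTsq x : GTsq (tg0 p') x <-> GTsq (tg0 p) (x - coset g).
Proof.
rewrite !GTsqP gram_degree cosetD cosetN mulr2n cosetD; split=> e.
  by rewrite -[in RHS]e; abel.
by rewrite -[RHS](subrK (coset g)) -e; abel.
Qed.

(* Sylvester's law of inertia: a vector supported on the e'-part of the block
   of x whose image under Q avoids the e-part of the block of y would give the
   two sides of the Gram identity opposite signs. *)
Lemma gram_cnt_le x (e s : int) (a : R) : GTsq (tg0 p') x ->
  let y := x - coset g in
  let u := - xi y - g + xi x in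
  let t := tau xi (tg0 p) y in
  X u * X t * X u = a *: X (t + u *+ 2) ->
  e = 1 \/ e = -1 -> s = 1 \/ s = -1 ->
  0 < s%:~R * (r * (mu t)%:~R * a) ->
  (cnt o' x (s * e) <= cnt o y e)%N.
Proof.
move=> xsq y u t XuE e1 s1 spos; rewrite leqNgt; apply/negP => lt.
have ysq : GTsq (tg0 p) y by apply/gram_GTsq.
have uT : u \in T by apply: shift_supp.
have tT : t \in T.
  move/GTsqP: ysq => yy; have := xi_sum_supp (tg0 p) y.
  by rewrite yy -addrA -mulr2n.
have t'E : tau xi (tg0 p') x = t + u *+ 2.
  by rewrite /tau gram_degree /t /u /tau; abel.
have t'T : t + u *+ 2 \in T by rewrite rpredD ?rpredMn.
have [q qE] := shift_coef QG.
have [v [[a0 va0] vB vA]] := underdetermined q lt.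
pose V : 'cV[D]_(msize o') := \col_a cst (v a).
pose w b := \sum_a q b a * v a.
have v_out a1 : cl a1 <> x -> v a1 = 0.
  by move=> ca; rewrite vB // inE; apply/negP => /andP[/eqP].
have lhs : (star V *m F' *m V) 0 0 =
    (\sum_(a1 | cl a1 == x) nsq (v a1) * (sg a1)%:~R) *: X (t + u *+ 2).
  have FI : map_mx idfun F' = F' by apply: map_mx_id.
  have := herm_value (c := idfun) (w := v) (Y := 1) (W := V) (sign_twist_id) xsq.
  rewrite FI mul1r mulr1 t'E; apply.
  - exact: phi0_1.
  - by move=> a1 _; rewrite mxE mulr1.
  - by move=> a1 /v_out v0; rewrite mxE v0 cst0.
have rhs : (star (Q *m V) *m map_mx c F *m (Q *m V)) 0 0 =
    (\sum_(b | cl b == y) nsq (w b) * (sg b)%:~R) *: (X u * c (X t) * X u).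
  apply: (herm_value (w := w) c_twist ysq (phi0_X uT)) => b cb; rewrite mxE.
    rewrite cst_sum mulr_suml; apply: eq_bigr => a1 _; rewrite mxE.
    have [ca|/eqP nca] := eqVneq (cl a1) x; last first.
      by rewrite v_out // mulr0 cst0 mulr0 mul0r.
    by rewrite qE ?cb ?ca // -mulrA -cst_comm mulrA -cstM.
  apply: big1 => a1 _; rewrite mxE.
  have [ca|/eqP nca] := eqVneq (cl a1) x; last by rewrite v_out // cst0 mulr0.
  by rewrite (shift_eq0 QG) ?mul0r // ca.
have cXt : c (X t) = (mu t)%:~R * X t by case: c_twist => _ _ _ _ /(_ t tT)[].
set SL := (X in X *: _) in lhs; set SR := (X in X *: _) in rhs.
(* The Gram identity evaluated at [V]: both sides are real multiples of X_(t + 2u). *)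
have key : r * SL = SR * ((mu t)%:~R * a).
  have : (r * SL) *: X (t + u *+ 2) = (SR * ((mu t)%:~R * a)) *: X (t + u *+ 2).
    rewrite -scalerA -lhs -[RHS]scalerA -scalerA -XuE.
    have -> : (mu t)%:~R *: (X u * X t * X u) = X u * c (X t) * X u.
      by rewrite cXt scaler_int mulrzl mulrzAr mulrzAl.
    rewrite -rhs star_mul !mulmxA.
    have -> : star V *m star Q *m map_mx c F *m Q *m V =
        star V *m (star Q *m map_mx c F *m Q) *m V by rewrite !mulmxA.
    by rewrite QFQ (mul_mx_real) -scalemxAl [RHS]mxE mulr_algl.
  move/eqP; rewrite -subr_eq0 -scalerBl scaler_eq0 (negPf (X_neq0 t'T)) orbF subr_eq0.
  by move/eqP.
have SLE : SL = s%:~R * (e%:~R * \sum_(a1 | cl a1 == x) nsq (v a1)).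
  rewrite mulrA -intrM mulr_sumr; apply: eq_bigr => a1 /eqP ca.
  have [->|v0] := eqVneq (v a1) 0; first by rewrite /nsq /= !expr0n /= addr0 mulr0 mul0r.
  have : a1 \in [set a2 : 'I_(msize o') | (cl a2 == x) && (sg a2 == (s * e)%R)].
    by apply: contraNT v0 => /vB ->.
  by rewrite inE => /andP[_ /eqP ->]; rewrite mulrC.
have SRE : SR = - (e%:~R * \sum_(b | cl b == y) nsq (w b)).
  rewrite mulr_sumr -sumrN; apply: eq_bigr => b /eqP cb.
  have [sb|/eqP sb] := eqVneq (sg b) e.
    have -> : w b = 0 by apply: vA; rewrite inE cb sb !eqxx.
    by rewrite /nsq /= !expr0n /= addr0 mulr0 mul0r oppr0.
  have -> : sg b = - e by case: (sgP b) e1 sb => -> [] ->.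
  by rewrite mulrC rmorphN mulNr.
set Sv := (X in s%:~R * (_ * X)) in SLE; set Sw := (X in - (_ * X)) in SRE.
have Sv0 : 0 < Sv.
  rewrite lt_neqAle eq_sym sumr_ge0 ?andbT => [|a1 _]; last exact: nsq_ge0.
  rewrite psumr_eq0 => [|a1 _]; last exact: nsq_ge0.
  apply/negP => /allP/(_ a0); rewrite mem_index_enum => /(_ isT)/implyP.
  rewrite nsq_eq0 (negPf va0) => h; suff : false by []; apply: h.
  by apply: contraNT va0 => /eqP/v_out ->.
have Sw0 : 0 <= Sw by apply: sumr_ge0 => b _; apply: nsq_ge0.
(* The sign [e] cancels. By the choice of [s] the two sides then contradict [Sv] > 0 and [Sw] >=
   0. *)
have key' : r * (s%:~R * Sv) = - (Sw * ((mu t)%:~R * a)).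
  move: key; rewrite SLE SRE; case: e1 => ->; first by rewrite !mul1r mulNr.
  by rewrite !rmorphN !mulN1r !opprK !mulrN => <-; rewrite opprK.
have : 0 < s%:~R * (r * (mu t)%:~R * a) * Sv by rewrite mulr_gt0.
have -> : s%:~R * (r * (mu t)%:~R * a) * Sv = r * (s%:~R * Sv) * ((mu t)%:~R * a).
  by ring.
rewrite key' mulNr -mulrA oppr_gt0 ltNge mulr_ge0 //.
by rewrite -expr2 sqr_ge0.
Qed.

(** [gram_cnt_le] for both signs gives two inequalities between the counts; as the totals agree by
    [gram_kappa], both are equalities. *)
Lemma gram_sigma x :
  let y := x - coset g in
  let u := - xi y - g + xi x in
  let t := tau xi (tg0 p) y in
  tsigma p' x = sgD ((X (t + u *+ 2))^-1 * X u * X t * X u) *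
    (sgz r * (mu t * tsigma p y)).
Proof.
move=> y u t.
have [xsq|nxsq] := pselect (GTsq (tg0 p') x); last first.
  rewrite (sigma_eq0 p'X nxsq) (sigma_eq0 pX) ?mulr0 //.
  by move=> /gram_GTsq.
have ysq : GTsq (tg0 p) y by apply/gram_GTsq.
have uT : u \in T by apply: shift_supp.
have tT : t \in T.
  move/GTsqP: ysq => yy; have := xi_sum_supp (tg0 p) y.
  by rewrite yy -addrA -mulr2n.
have [a [a0 XuE ->]] := twist_factor tT uT.
have mu1 : mu t = 1 \/ mu t = -1 by case: c_twist => _ _ _ _ /(_ t tT)[].
pose s := sgz a * (sgz r * mu t).
have s1 : s = 1 \/ s = -1.
  rewrite /s; case: (sgz_pm1 a0) => ->; case: (sgz_pm1 r0) => ->;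
    case: mu1 => ->; auto.
have spos : 0 < s%:~R * (r * (mu t)%:~R * a).
  rewrite /s !intrM -!sgrEz.
  have -> : Num.sg a * (Num.sg r * (mu t)%:~R) * (r * (mu t)%:~R * a) =
      (Num.sg a * a) * (Num.sg r * r) * ((mu t)%:~R * (mu t)%:~R) by ring.
  rewrite -!normrEsg; have -> : (mu t)%:~R * (mu t)%:~R = 1 :> R.
    by case: mu1 => ->; rewrite ?mulr1 // mulrNN mulr1.
  by rewrite mulr1 mulr_gt0 ?normr_gt0.
have le1 := gram_cnt_le xsq XuE (or_introl erefl) s1 spos.
have le2 := gram_cnt_le xsq XuE (or_intror erefl) s1 spos.
have := cnt_add o' x; rewrite gram_kappa -(cnt_add o y).
rewrite (sigma_cnt p'X o' xsq) (sigma_cnt pX o ysq) !mulrA -/s.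
rewrite -[sgz a * sgz r * mu t]mulrA -/s.
move: le1 le2; case: s1 => ->; rewrite ?mulr1 ?mul1r ?mulN1r ?opprK -/y;
  move: (cnt o' x 1) (cnt o' x (-1)) (cnt o y 1) (cnt o y (-1)) => m1 m2 n1 n2;
  lia.
Qed.

End FromGram.

Lemma gram_orbit (mu : G -> int) (c : {rmorphism D -> D}) (p p' : triple D)
    (o : enumeration p) (o' : enumeration p') : sign_twist mu c ->
  in_X p -> in_X p' -> gram_rel o o' c ->
  same_orbit X xi (nu_twist xi mu p) p'.
Proof.
move=> c_twist pX p'X [g [Q [P [r [PQ QP [QG PG] r0 QFQ]]]]].
(* The sign epsilon of the orbit is that of the real factor of the Gram identity. *)
exists g, (sgz r); split; first exact: sgz_pm1.
have e1 := gram_degree c_twist p'X QG r0 QFQ.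
have e2 := gram_kappa PQ QP QG PG.
have e3 := gram_sigma c_twist pX p'X PQ QP QG PG r0 QFQ.
case: p' {p'X o' Q P PQ QP QG PG QFQ} e1 e2 e3 => g0 k s /= -> e2 e3.
by rewrite /act /act_sign /nu_twist /=; congr Triple; apply: funext.
Qed.
(** * A monomial Gram matrix *)

Section Monomial.
Variables (mu : G -> int) (c : {rmorphism D -> D}).
Hypothesis c_twist : sign_twist mu c.
Variables (p p' : triple D) (pX : in_X p) (p'X : in_X p').
Variables (o : enumeration p) (o' : enumeration p').
Local Notation F := (Phi X xi o).
Local Notation F' := (Phi X xi o').
Variables (g : G) (eps : int).
Local Notation y x := (x - coset g).
Local Notation u x := (- xi (y x) - g + xi x).
Hypothesis eps1 : eps = 1 \/ eps = -1.
Hypothesis g0E : tg0 p' = tg0 p - g *+ 2.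
Hypothesis kappaE : forall x, tkappa p' x = tkappa p (y x).
Local Notation s x :=
  (sgD ((X (tau xi (tg0 p) (y x) + u x *+ 2))^-1 * X (u x) *
       X (tau xi (tg0 p) (y x)) * X (u x)) * (eps * mu (tau xi (tg0 p) (y x)))).
Hypothesis sigmaE : forall x, tsigma p' x = s x * tsigma p (y x).

Let bar x := - coset (tg0 p') - x.
Let t x := tg0 p + xi (y x) + xi (y (bar x)).
Let t' x := tg0 p' + xi x + xi (bar x).

Let barK x : bar (bar x) = x. Proof. exact: mate_involutive. Qed.

Let y_bar x : y (bar x) = - coset (tg0 p) - y x.
Proof. by rewrite /bar g0E cosetD cosetN mulr2n cosetD; abel. Qed.

Let t_bar x : t (bar x) = t x. Proof. by rewrite /t barK; abel. Qed.
Let t'_bar x : t' (bar x) = t' x. Proof. by rewrite /t' barK; abel. Qed.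

Let uT x : u x \in T. Proof. exact: shift_supp. Qed.
Let tT x : t x \in T. Proof. by rewrite /t y_bar; apply: xi_sum_supp. Qed.
Let t'T x : t' x \in T. Proof. exact: xi_sum_supp. Qed.

Let t_fixed x : GTsq (tg0 p') x -> t x = tau xi (tg0 p) (y x).
Proof. by move=> /GTsqP xx; rewrite /t /bar xx /tau mulr2n addrA. Qed.

Let mu_t x : mu (t x) = 1 \/ mu (t x) = -1.
Proof. by case: c_twist => _ _ _ _ /(_ (t x) (tT x))[]. Qed.

Let coef_ex x : exists z, z != 0 /\ X (u x) * X (t x) * X (u (bar x)) = cst z * X (t' x).
Proof.
have XXG : X (u x) * X (t x) \in Dg (u x + t x) by rewrite gr_mul ?X_gr.
have XXXG : X (u x) * X (t x) * X (u (bar x)) \in Dg (t' x).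
  by apply: gr_cast (gr_mul XXG (X_gr (uT (bar x)))) _; rewrite /t /t' g0E; abel.
have [z zE] := gr_line (t'T x) XXXG; exists z; split=> //.
apply: contra_eq_neq zE => ->; rewrite cst0 mul0r.
rewrite (gr_mulf_neq0 XXG (X_gr (uT _))) ?X_neq0 //.
by rewrite (gr_mulf_neq0 (X_gr (uT _)) (X_gr (tT _))) ?X_neq0.
Qed.

Let y_GTsq x : GTsq (tg0 p') x <-> GTsq (tg0 p) (y x).
Proof.
by rewrite !GTsqP -y_bar; split=> [e|/addIr//]; rewrite /bar e.
Qed.

Let fixed_coef x z : GTsq (tg0 p') x ->
  X (u x) * X (t x) * X (u (bar x)) = cst z * X (t' x) ->
  exists a : R, [/\ a != 0, z = (a%:C)%C & s x = sgz a * (eps * mu (t x))].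
Proof.
move=> xsq; rewrite t_fixed //; have /GTsqP xx := xsq; rewrite /bar xx => zE.
have := twist_factor (tT x) (uT x); rewrite t_fixed // => -[a [a0 aE ->]].
exists a; split=> //; apply: (cst_inj_X (t'T x)).
rewrite -zE aE cstR mulr_algl; congr (_ *: X _).
by rewrite /t' /bar xx /tau g0E; abel.
Qed.

(** If s = -1, the numbers of positive and negative rows are interchanged. Positive rows come first,
    so reversing the block, k |-> kappa - 1 - k, matches the signs. *)
Let sg_fixed (a : 'I_(msize o')) (b : 'I_(msize o)) :
  GTsq (tg0 p') (cl a) -> cl b = y (cl a) -> s (cl a) = 1 \/ s (cl a) = -1 ->
  pos b = (if s (cl a) == -1 then ((tkappa p' (cl a)).-1 - pos a)%N else pos a) ->
  sg a = s (cl a) * sg b.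
Proof.
move=> asq cb s1 pb; have bsq : GTsq (tg0 p) (y (cl a)) by apply/y_GTsq.
have [h1 h2] := npos_spec p'X asq; have [h3 h4] := npos_spec pX bsq.
have := pos_lt a; move: h2; rewrite /sg cb !asboolT //= pb.
rewrite sigmaE; move: h1 h3 h4; rewrite -kappaE.
move: (npos p' (cl a)) (npos p (y (cl a))) (tkappa p' (cl a)) (pos a) => m n k i.
move: (tsigma p (y (cl a))) => w; case: s1 => -> /= h1 h3 h4 h2 hi.
  by case: (ltnP i m) => ?; case: (ltnP i n) => ? /=; lia.
by case: (ltnP i m) => ?; case: (ltnP (k.-1 - i) n) => ? /=; lia.
Qed.

(** Q has the entries q(x) X_u at the positions (pi a, a), where the bijection pi sends block x to
    block x - g. The Gram identity then reduces to one scalar equation for each row, which fixes the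
    choice of q. *)
Lemma monomial_gram : gram_rel o o' c.
Proof.
have [z zP] := choice coef_ex.
have z0 x : z x != 0 by case: (zP x).
have zE x : X (u x) * X (t x) * X (u (bar x)) = cst (z x) * X (t' x) by case: (zP x).
(* Applying [phi0] reverses the product, which exchanges x and [bar x]. *)
have z_bar x : conjc (z x) = z (bar x).
  apply: (cst_inj_X (t'T x)).
  have := congr1 phi0 (zE x); rewrite phi0_line // !phi0M !phi0_X // => <-.
  by have := zE (bar x); rewrite barK t_bar t'_bar -mulrA.
(* In a pair of blocks exchanged by bar, the scalar is put on the second one. *)
pose first x := (index x (codom (ox (e := o'))) < index (bar x) (codom (ox (e := o'))))%N.
have clS (a : 'I_(msize o')) : cl a \in codom (ox (e := o')) by exact: codom_f.
have first_bar (a : 'I_(msize o')) : bar (cl a) <> cl a ->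
    first (bar (cl a)) = ~~ first (cl a).
  move=> ne; rewrite /first barK -leqNgt ltn_neqAle andb_idl // => _.
  apply/eqP => e; have [b /andP[/eqP cb _]] := partner_ex p'X a.
  have bS : bar (cl a) \in codom (ox (e := o')) by rewrite -[bar _]cb.
  by apply: ne; have := congr1 (nth 0 (codom (ox (e := o')))) e; rewrite !nth_index.
(* On a fixed block z is real, and q scales it to absolute value 1. On an exchanged pair only the
   product of conj q(x) and q(bar x) is prescribed. *)
pose q x : R[i] := if `[< GTsq (tg0 p') x >]
  then ((Num.sqrt `|complex.Re (z x)|)^-1)%:C%C
  else if first x then 1 else (eps * mu (t x))%:~R / z (bar x).
(* Reversing a block exchanges its positive and negative parts. *)
pose flip x := `[< GTsq (tg0 p') x >] && (s x == -1).
pose rho x k := if flip x then ((tkappa p' x).-1 - k)%N else k.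
have rho_lt x k : (k < tkappa p' x)%N -> (rho x k < tkappa p' x)%N.
  by rewrite /rho; case: (flip x) => //; lia.
have rhoK x k : (k < tkappa p' x)%N -> rho x (rho x k) = k.
  by rewrite /rho; case: (flip x) => //; lia.
have pi_ex (a : 'I_(msize o')) : exists b : 'I_(msize o),
    cl b = y (cl a) /\ pos b = rho (cl a) (pos a).
  by apply: cl_pos_ex; rewrite -kappaE; apply/rho_lt/pos_lt.
have pi'_ex (b : 'I_(msize o)) : exists a : 'I_(msize o'),
    cl a = cl b + coset g /\ pos a = rho (cl b + coset g) (pos b).
  by apply: cl_pos_ex; apply: rho_lt; rewrite kappaE addrK pos_lt.
have [pi piP] := choice pi_ex; have [pi' pi'P] := choice pi'_ex.
have piK : cancel pi pi'.
  move=> a; have [b1 b2] := piP a; have [a1 a2] := pi'P (pi a).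
  apply: cl_pos_inj; rewrite ?a1 ?a2 b1 subrK //.
  by rewrite b2 rhoK ?pos_lt.
have pi'K : cancel pi' pi.
  move=> b; have [a1 a2] := pi'P b; have [b1 b2] := piP (pi' b).
  apply: cl_pos_inj; rewrite ?b1 ?b2 a1 ?addrK //.
  by rewrite a2 rhoK // kappaE addrK pos_lt.
have partner_pi a a' : partner (pi a) (pi a') = partner a a'.
  have [b1 b2] := piP a; have [b1' b2'] := piP a'.
  rewrite /partner b1 b1' b2 b2' -y_bar (inj_eq (addIr _)) -/(bar (cl a)).
  case: eqP => //= ca'; rewrite ca' /rho /flip.
  have [/GTsqP fx|nfx] := pselect (GTsq (tg0 p') (cl a)).
    have [fx' ->] : bar (cl a) = cl a /\ bar (cl a) = cl a by rewrite /bar fx.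
    case: ifP => // _; have := pos_lt a; have := pos_lt a'; rewrite ca' fx'.
    by move=> h1 h2; apply/eqP/eqP; lia.
  have nfx' : ~ GTsq (tg0 p') (bar (cl a)).
    by move=> /GTsqP; rewrite -/(bar _) barK => fx; apply: nfx; apply/GTsqP.
  by rewrite !asboolF.
have cst_int (n : int) : cst n%:~R = n%:~R by rewrite /cst rmorph_int.
have s_pm1 x : GTsq (tg0 p') x -> s x = 1 \/ s x = -1.
  move=> xsq; have [a [a0 _ ->]] := fixed_coef xsq (zE x).
  by case: (sgz_pm1 a0) => ->; case: eps1 => ->; case: (mu_t x) => ->; auto.
(* The nonzero entry of the Gram identity in row [a], divided by X_(t'). *)
have key (a : 'I_(msize o')) (x := cl a) :
    conjc (q x) * q (bar x) * (sg (pi a) * mu (t x))%:~R * z x = (eps * sg a)%:~R.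
  have [b1 b2] := piP a.
  have mu2 : (mu (t x))%:~R * (mu (t x))%:~R = 1 :> R[i].
    by case: (mu_t x) => ->; rewrite ?mulr1 // mulrNN mulr1.
  have [xsq|nxsq] := pselect (GTsq (tg0 p') x).
    have [al [al0 zal sal]] := fixed_coef xsq (zE x).
    have -> : sg a = s x * sg (pi a).
      apply: sg_fixed => //; first exact: s_pm1.
      by rewrite b2 /rho /flip asboolT.
    have -> : bar x = x by apply/GTsqP.
    rewrite /q asboolT // zal sal -[complex.Re _]/al.
    set k := (Num.sqrt _)^-1.
    have -> : conjc (k%:C)%C = (k%:C)%C by apply/eqP; rewrite eq_complex /= oppr0 !eqxx.
    have kal : k * k * al = (sgz al)%:~R.
      rewrite -sgrEz /k -invfM -expr2 sqr_sqrtr // mulrC.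
      by rewrite {1}[al]numEsg mulfK // normr_eq0.
    rewrite mulrAC -!rmorphM /= kal rmorph_int -intrM; congr (_%:~R).
    by case: eps1 => ->; ring.
  have nfx : ~ bar x = x by move=> /GTsqP.
  have nbx : ~ GTsq (tg0 p') (bar x).
    by move=> /GTsqP; rewrite -/(bar _) barK => e; apply: nfx.
  have -> : sg a = 1 by rewrite /sg asboolF.
  have -> : sg (pi a) = 1.
    by rewrite /sg asboolF // b1 => /y_GTsq.
  have -> : conjc (q x) * q (bar x) = (eps * mu (t x))%:~R / z x.
    rewrite /q !asboolF // first_bar // barK t_bar.
    case: (first x).
      transitivity (conjc 1 * ((eps * mu (t x))%:~R / z x)) => //.
      by rewrite rmorph1 mul1r.
    transitivity (conjc ((eps * mu (t x))%:~R / z (bar x)) * 1) => //.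
    by rewrite mulr1 rmorphM fmorphV rmorph_int /= z_bar barK.
  rewrite mulrAC divfK // -intrM; congr (_%:~R).
  by case: (mu_t x) => ->; rewrite ?mulrN ?mulrNN !mulr1 ?opprK.
pose d (a : 'I_(msize o')) := cst (q (cl a)) * X (u (cl a)).
have q0 (a : 'I_(msize o')) : q (cl a) != 0.
  apply/eqP => qa; have /= := key a; rewrite qa conjc0 !mul0r => /esym/eqP.
  by rewrite intr_eq0; case: eps1 => ->; case: (sgP a) => ->.
have dG a : d a \in Dg (u (cl a)).
  exact: (cst_gr_mul _ (X_gr (uT (cl a)))).
have d0 a : d a != 0.
  apply: (gr_mulf_neq0 (cst_gr _) (X_gr (uT (cl a)))).
    by rewrite (cst_eq0).
  exact: X_neq0.
have ud a : d a \is a GRing.unit := gr_unit (dG a) (d0 a).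
have [QP PQ] := monomial_inv piK pi'K (fun a => mulrV (ud a)) (fun a => mulVr (ud a)).
set Q := (X in X *m _ = _) in QP; set P := (X in _ *m X = _) in QP.
exists g, Q, P, eps%:~R; split=> //; last first.
  apply/matrixP => a a'.
  have -> : (star Q *m map_mx c F *m Q) a a' =
      phi0 (d a) * c (F (pi a) (pi a')) * d a'.
    rewrite mxE (bigD1 (pi a')) //= big1 ?addr0 => [|b' /negPf bb']; last first.
      by rewrite [Q b' a']mxE bb' mulr0.
    rewrite [Q (pi a') a']mxE eqxx; congr (_ * _).
    rewrite mxE (bigD1 (pi a)) //= big1 ?addr0 => [|b /negPf bb].
      by rewrite starE [Q (pi a) a]mxE eqxx mxE.
    by rewrite starE [Q b a]mxE bb linear0 mul0r.
  rewrite [RHS]mxE [in RHS]PhiE [F _ _]PhiE -!/(partner _ _) partner_pi.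
  case: ifP => [aa'|_]; last by rewrite rmorph0 !mulr0 mul0r.
  have [/eqP ca' _] := andP aa'; have [b1 _] := piP a; have [b1' _] := piP a'.
  rewrite b1 b1' ca' -/(bar (cl a)) -/(t (cl a)) -/(t' (cl a)).
  have [_ _ _ _ /(_ _ (tT (cl a)))[cX _]] := c_twist.
  rewrite rmorphM rmorph_int cX /d phi0_line // ca' -/(bar (cl a)).
  have e1 : (sg (pi a))%:~R * ((mu (t (cl a)))%:~R * X (t (cl a))) =
      cst (sg (pi a) * mu (t (cl a)))%:~R * X (t (cl a)).
    by rewrite mulrA -intrM cst_int.
  rewrite e1 !(cst_mulACA) zE mulrA -cstM [_ * q (bar _)]mulrAC.
  have /= -> := key a.
  by rewrite cst_int intrM mulr_algl scaler_int -mulrA !mulrzl.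
- by rewrite intr_eq0; case: eps1 => ->.
- split=> [b a|a b]; rewrite mxE; case: eqP => [->|_]; rewrite ?mem0v //.
    by have [-> _] := piP a; apply: dG.
  have [-> _] := piP a; apply: gr_cast (gr_inv (dG a) (d0 a)) _; abel.
Qed.

End Monomial.

Lemma orbit_gram (mu : G -> int) (c : {rmorphism D -> D}) (p p' : triple D)
    (o : enumeration p) (o' : enumeration p') : sign_twist mu c ->
  in_X p -> in_X p' -> same_orbit X xi (nu_twist xi mu p) p' ->
  gram_rel o o' c.
Proof.
move=> c_twist pX p'X [g [eps [eps1 p'E]]].
apply: (monomial_gram c_twist pX p'X o o' eps1 (g := g)).
- by rewrite p'E.
- by move=> x; rewrite p'E.
- by move=> x; rewrite {1}p'E /= !mulrA.
Qed.

Lemma nu_twist1 (p : triple D) : nu_twist xi (fun=> 1) p = p.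
Proof.
by case: p => g0 k s; rewrite /nu_twist /=; congr Triple; apply: funext => x; rewrite mul1r.
Qed.

End Classification.

(** * The two cases of the classification *)

Theorem corollary28 (R : realType) (G : zmodType) (D : grDivAlg R G)
  (iota : {lrmorphism Rcomplex R -> D}) (phi0 : {linear D -> D})
  (X : G -> D) (xi : GT D -> G)
  (center_C : iso_center iota)
  (center_triv : ('Z({:D}) <= gr_comp D 0)%VS)
  (phi0_inv : is_involution phi0)
  (phi0_deg : forall t d, d \in gr_comp D t -> phi0 d \in gr_comp D t)
  (phi0_conj : forall z : R[i], phi0 (iota z) = iota (conjc z))
  (X_spec : forall t, t \in supp D ->
     [/\ X t != 0, X t \in gr_comp D t & phi0 (X t) = X t])
  (xi_section : forall x, cosetT D (xi x) = x)
  (p p' : triple D) (pX : in_X p) (p'X : in_X p')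
  (o : enumeration p) (o' : enumeration p') :
  (~ elementary2 D ->
     (M_iso phi0 X xi o o' <-> same_orbit X xi p p')) /\
  (elementary2 D -> forall nu : G -> int, is_quad X nu ->
     (M_iso phi0 X xi o o' <->
        same_orbit X xi p p' \/ same_orbit X xi (nu_twist xi nu p) p')).
Proof.
(* Used with the identity for the orbit of [p], and with the extension of the conjugation for the
   orbit of its [nu]-twist. *)
have gram_iff (mu : G -> int) (c : {rmorphism D -> D}) : sign_twist phi0 X mu c ->
    gram_rel phi0 X xi o o' c <-> same_orbit X xi (nu_twist xi mu p) p'.
  move=> c_twist; split=> [gr|orb].
    exact: (gram_orbit center_C center_triv phi0_inv phi0_deg phi0_conj X_spec
      xi_section c_twist pX p'X gr).
  exact: (orbit_gram center_C center_triv phi0_inv phi0_conj X_spec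
    xi_section o o' c_twist pX p'X orb).
have id_twist := sign_twist_id phi0 X.
have gram_id := gram_iff _ _ id_twist; rewrite nu_twist1 in gram_id.
have gram_iso mu (c : {rmorphism D -> D}) : sign_twist phi0 X mu c ->
    gram_rel phi0 X xi o o' c -> M_iso phi0 X xi o o'.
  by move=> c_twist; apply: (gram_M_iso center_C phi0_inv X_spec xi_section pX p'X c_twist).
have iso_gram := M_iso_gram center_C center_triv phi0_inv phi0_conj X_spec
  xi_section pX p'X (o := o) (o' := o').
split=> [ne2|e2 nu nu_quad].
  split=> [/iso_gram[/gram_id//|[/ne2]]//|/gram_id].
  exact: gram_iso id_twist.
have [c [c_twist c_conj]] :=
  sign_twist_conj center_C center_triv phi0_inv phi0_deg phi0_conj X_spec nu_quad.
split=> [/iso_gram[/gram_id|[_ /(_ nu c c_twist c_conj)/(gram_iff _ _ c_twist)]]|].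
- by left.
- by right.
by move=> [/gram_id/(gram_iso _ _ id_twist)|/(gram_iff _ _ c_twist)/(gram_iso _ _ c_twist)].
Qed.
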